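(* Let $X=(X(t),t\in\mathbb{R})$ be a real-valued centered stationary Gaussian process with continuous sample paths, whose covariance function $R_X$ is positive and satisfies $R_X(t)=L(t)/|t|^\beta$ with $0<\beta<1$ and $L$ slowly varying at infinity. Let $\mathcal{W}_\beta$ be the (nonempty) set of Borel probability measures on $[0,1]$ minimizing $\int_0^1\int_0^1|u-v|^{-\beta}\mu(du)\mu(dv)$. Then for any $\mu_\beta\in\mathcal{W}_\beta$, $$\lim_{a\to\infty}R_X(a)\,C_X(a)=\Big(\int_0^1\!\!\int_0^1\frac{\mu_\beta(du)\,\mu_\beta(dv)}{|u-v|^\beta}\Big)^{-1}.$$
   Context: For $a>0$, $C_X(a)$ is defined by $\lim_{u\to\infty}u^{-2}\log P(X(t)>u,\ 0\le t\le a)=-\frac12C_X(a)$; equivalently $C_X(a)=\big[\min_{\mu}\int_0^1\int_0^1R_X(a(u-v))\mu(du)\mu(dv)\big]^{-1}$, the minimum over Borel probability measures $\mu$ on $[0,1]$. *)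

(* Defs.v *)
From HB Require Import structures.
From mathcomp Require Import all_boot all_order all_algebra.
From mathcomp Require Import all_classical all_reals all_analysis.
Set Implicit Arguments. Unset Strict Implicit. Unset Printing Implicit Defensive.
Import Order.TTheory GRing.Theory Num.Theory.
Import numFieldNormedType.Exports.
Local Open Scope classical_set_scope.
Local Open Scope ring_scope.

Definition prob01 {R : realType} : set (probability R R) :=
  [set mu : probability R R | mu (`[0%R, 1%R]%classic) = 1%E].

Definition energy {R : realType} (mu : probability R R) (K : R -> R -> \bar R)
  : \bar R :=
  (\int[mu]_(v in `[0%R, 1%R]%classic) \int[mu]_(u in `[0%R, 1%R]%classic) K u v)%E.

Definition riesz_kernel {R : realType} (beta : R) (u v : R) : \bar R :=
  if u == v then +oo%E else (`|u - v| `^ (- beta))%:E.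

Definition CX {R : realType} (RX : R -> R) (a : R) : R :=
  (fine (ereal_inf [set energy mu (fun u v => (RX (a * (u - v)))%:E)
                    | mu in prob01]))^-1.

Definition slowly_varying {R : realType} (L : R -> R) : Prop :=
  measurable_fun setT L /\
  (\forall x \near +oo, 0 < L x) /\
  (forall c : R, 0 < c -> (fun x => L (c * x) / L x) @ +oo --> (1 : R)).

Definition centered_gaussian {d} {T : measurableType d} {R : realType}
  (P : probability T R) (Y : T -> R) : Prop :=
  exists s : R,
    (s = 0 /\ forall A : set R, measurable A -> P (Y @^-1` A) = \d_(0 : R) A) \/
    (0 < s /\ forall A : set R, measurable A -> P (Y @^-1` A) = normal_prob 0 s A).

Definition centered_gaussian_process {d} {T : measurableType d} {R : realType}
  (P : probability T R) (X : R -> T -> R) : Prop :=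
  (forall t, measurable_fun setT (X t)) /\
  (forall (n : nat) (t : 'I_n -> R) (c : 'I_n -> R),
      centered_gaussian P (fun w => \sum_(i < n) c i * X (t i) w)).

(* Main.v *)
Require Import Defs.
From HB Require Import structures.
From mathcomp Require Import all_boot all_order all_algebra.
From mathcomp Require Import all_classical all_reals all_analysis.
From mathcomp Require Import measurable_realfun ring lra.
Import Order.TTheory GRing.Theory Num.Theory.
Import numFieldNormedType.Exports.
Local Open Scope classical_set_scope.
Local Open Scope ring_scope.

(** By the uniform convergence theorem and Potter's bounds the normalized kernel
    [RX (a y) / RX a] is, for large [a], at most [(1+o(1)) y^-(beta+e)] and at least
    [(1-o(1)) max(y, delta)^-beta], for every [e], [delta > 0]; the lower bound near [y = 0]
    uses that the covariance of a Gaussian process with continuous paths is continuous.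

    Both inequalities between minimal energies then follow from one regularization, which
    replaces a compactness argument. Let [mu_eta] be the law of [(1-eta) x + eta s] with [x] of
    law [mu] and [s] uniform on [0, 1]. For a kernel bounded by [|u-v|^-beta], the energy of
    [mu_eta] is at most the [mu]-energy of a bounded kernel that is close to [|u-v|^-beta] for
    [|u-v| >> eta] and of order [eta^-beta] otherwise. Averaging over [N] scales
    [eta_j ~ 2^(-j/beta)] makes the contribution of the second range negligible pointwise, so
    the average of these kernels is at most [(1+theta) max(|u-v|, delta)^-beta]. For the Riesz
    kernel this bounds the minimal Riesz energy by the energy of every [mu] for the truncated
    kernel, hence for [RX (a (u-v)) / RX a]; applied to [mu_beta] and [RX (a (u-v)) / RX a] it
    gives the converse bound. *)

(** * Slowly varying functions *)

(** Continuity from below: the measures of [F n] increase to that of the union, which is at least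
    [mu A]. *)
Lemma measure_exhaust d (T : measurableType d) (R : realType)
    (mu : {measure set T -> \bar R}) (F : (set T)^nat) (A : set T) (c : \bar R) :
  (forall n, measurable (F n)) -> nondecreasing_seq F -> measurable A ->
  A `<=` \bigcup_n F n -> (c < mu A)%E ->
  exists N, forall n, (N <= n)%N -> (c < mu (F n))%E.
Proof.
move=> mF ndF mA AF cA; apply: contrapT => /forallNP H.
have mUF : measurable (\bigcup_n F n) by exact: bigcupT_measurable.
have cvgF : mu \o F @ \oo --> mu (\bigcup_n F n).
  exact: nondecreasing_cvg_mu.
have : (mu (\bigcup_n F n) <= c)%E; last first.
  apply/negP; rewrite -ltNge (lt_le_trans cA)//.
  by apply: le_measure; rewrite ?inE.
apply: cvge_to_le cvgF _; exists 0%N => // n _ /=.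
have /existsNP[m /not_implyP[nm /negP]] := H n.
rewrite -leNgt; apply: le_trans.
by apply: le_measure; rewrite ?inE//; apply/subsetPset; exact: ndF.
Qed.

(** Translation preserves the lengths of half-open intervals, and these determine Lebesgue
    measure. *)
Lemma lebesgue_measure_translation (R : realType) (c : R) (A : set R) :
  measurable A ->
  lebesgue_measure ((fun x : R => x + c) @^-1` A) = lebesgue_measure A.
Proof.
move=> mA.
have mc : measurable_fun [set: measurableTypeR R]
    (fun x : R => x + c : measurableTypeR R).
  by apply: measurable_funD.
pose f : {mfun measurableTypeR R >-> measurableTypeR R} :=
  HB.pack (fun x : R => x + c) (isMeasurableFun.Build _ _ _ _ _ mc).
rewrite -[LHS]/(pushforward (@lebesgue_measure R) f A).
apply/esym/lebesgue_measure_unique => //= _ [[a b]] _ <-.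
rewrite /pushforward.
have -> : f @^-1` [set` `]a, b]%R] = [set` `]a - c, b - c]%R].
  by apply/seteqP; split => x /=; rewrite !in_itv/= ltrBlDr lerBrDr.
rewrite !lebesgue_measure_itv/= !lte_fin ltrD2r; case: ifP => // _.
by rewrite -!EFinD; congr EFin; ring.
Qed.

(** [V n] collects the increments that stay good from index [n] on. These sets increase to all of
    [[0, 2]] because [x n] tends to infinity. The level 3/2 is chosen because two sets of larger
    measure cannot be disjoint inside [[0, 3]]. *)
Lemma slow_increments_exhaust (R : realType) (f : R -> R) (x : R^nat) (e : R) :
  measurable_fun setT f ->
  (forall u, f (x + u) - f x @[x --> +oo] --> (0 : R)) ->
  0 < e -> (forall n, n%:R <= x n) ->
  let V n := `[0, 2]%classic `&`
     \bigcap_(m in [set m | (n <= m)%N]) [set y : R | `|f (x m + y) - f (x m)| < e] in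
  (forall n, measurable (V n)) /\
  exists N, forall n, (N <= n)%N -> ((3/2)%:E < lebesgue_measure (V n))%E.
Proof.
move=> mf fslow e0 xn V.
have mV n : measurable (V n).
  apply: measurableI => //; apply: bigcap_measurable; first by exists n => /=.
  move=> m _.
  rewrite -[X in measurable X]setTI.
  have : measurable_fun setT (fun y : R => `|f (x m + y) - f (x m)|).
    apply: measurableT_comp => //; apply: measurable_funB => //.
    by apply: measurableT_comp => //; apply: measurable_funD.
  move=> /(_ measurableT _ (measurable_itv `]-oo, e[)).
  by congr measurable; congr (_ `&` _); apply/seteqP; split => y /=; rewrite in_itv.
split => //; apply: (@measure_exhaust _ (measurableTypeR R) R lebesgue_measure V `[0, 2]%classic) => //.
- move=> n m nm; apply/subsetPset; apply: setIS => y /= H k /= mk.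
  by apply: H => /=; exact: leq_trans mk.
- move=> y y02; have /cvgrPdist_lt/(_ _ e0)[M [_ HM]] := fslow y.
  have [N MN] : exists N : nat, M < N%:R.
    by exists (Num.truncn M).+1; exact: truncnS_gt.
  exists N => //; split => // m /= Nm.
  have := HM (x m); rewrite sub0r normrN; apply.
  by rewrite (lt_le_trans MN)// (le_trans _ (xn m))// ler_nat.
- rewrite /= lebesgue_measure_itv/= lte_fin ltr0n/= sube0 lte_fin; lra.
Qed.

(* For a large index the sets of good increments at [x_n] and at [x_n + u_n],
   the latter translated by [u_n], both fill more than half of [0, 3], hence meet. *)
Lemma slow_increments_uniform (R : realType) (f : R -> R) :
  measurable_fun setT f ->
  (forall u, f (x + u) - f x @[x --> +oo] --> (0 : R)) ->
  forall e : R, 0 < e -> exists X : R, forall x u : R, X <= x -> 0 <= u <= 1 ->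
    `|f (x + u) - f x| <= e.
Proof.
move=> mf fslow e e0; apply: contrapT => /forallNP H.
have {}H n : exists p : R * R, [/\ n%:R <= p.1, 0 <= p.2 <= 1
    & e < `|f (p.1 + p.2) - f p.1|].
  have /existsNP[x /existsNP[u /not_implyP[nx /not_implyP[u01 /negP]]]] := H n%:R.
  by rewrite -ltNge => ?; exists (x, u).
have /choice[p Hp] := H.
pose x n := (p n).1; pose u n := (p n).2.
have e20 : 0 < e / 2 by rewrite divr_gt0.
have xn n : n%:R <= x n by have [] := Hp n.
have xun n : n%:R <= x n + u n.
  by have [? /andP[? _] _] := Hp n; rewrite (le_trans (xn n))// lerDl.
have [mV [N1 HV]] := @slow_increments_exhaust R f x _ mf fslow e20 xn.
have [mW [N2 HW]] := @slow_increments_exhaust R f (fun n => x n + u n) _ mf fslow e20 xun.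
move: mV HV mW HW; set V := (X in forall n, measurable (X n)) => mV HV.
set W := (X in forall n, measurable (X n)) => mW HW.
pose n := maxn N1 N2.
have [_ /andP[un0 un1] gap] := Hp n.
pose W' := (fun y : R => y + - u n) @^-1` (W n).
have mW' : measurable W'.
  have mt : measurable_fun [set: R] (fun y : R => y + - u n).
    exact: measurable_funD.
  by rewrite -[X in measurable X]setTI; exact: mt.
(* A common point [y] would put [f (x n + y)] within [e / 2] of both [f (x n)] and [f (x n + u n)],
   against [gap]. *)
have VW : V n `&` W' = set0.
  rewrite -subset0 => y [[_ Vy] [_ Wy]].
  have /= := Vy n (leqnn n); have /= := Wy n (leqnn n).
  rewrite (_ : x n + u n + (y - u n) = x n + y); last by ring.
  move=> A1 A2; move: gap; apply/negP; rewrite -leNgt -/(x n) -/(u n).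
  rewrite (_ : f _ - f _ = (f (x n + y) - f (x n)) - (f (x n + y) - f (x n + u n))); last by ring.
  by rewrite (le_trans (ler_normB _ _))// [e in leRHS]splitr lerD// ltW.
have : (lebesgue_measure (V n `|` W') <= 3%:E)%E.
  rewrite (_ : 3%:E = lebesgue_measure `[0, 3 : R]%classic).
    apply: le_measure; rewrite ?inE//.
      exact: (@measurableU _ (measurableTypeR R) _ _ (mV n) mW').
    move=> y /= [[+ _]|[+ _]]; rewrite /= !in_itv/= => /andP[y0 y2];
      apply/andP; split; lra.
  by rewrite /= lebesgue_measure_itv/= lte_fin ltr0n/= sube0.
have -> : lebesgue_measure (V n `|` W') = (lebesgue_measure (V n) + lebesgue_measure (W n))%E.
  rewrite -(@lebesgue_measure_translation R (- u n) (W n))//.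
  exact: (@measureU _ _ (measurableTypeR R) lebesgue_measure _ _ (mV n) mW' VW).
apply/negP; rewrite -ltNge.
rewrite (_ : 3%:E = (3/2)%:E + (3/2)%:E)%E; last by rewrite -EFinD; congr EFin; lra.
by apply: lteD; [apply: HV; exact: leq_maxl|apply: HW; exact: leq_maxr].
Qed.

(** An increment [u] splits into at most [1 + u] steps of length at most 1, each costing [e]. *)
Lemma slow_increments_sublinear (R : realType) (f : R -> R) :
  measurable_fun setT f ->
  (forall u, f (x + u) - f x @[x --> +oo] --> (0 : R)) ->
  forall e : R, 0 < e -> exists X : R, forall x u : R, X <= x -> 0 <= u ->
    `|f (x + u) - f x| <= e * (1 + u).
Proof.
move=> mf fslow e e0; have [X HX] := @slow_increments_uniform R f mf fslow e e0.
exists X => x u Xx u0.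
have step (n : nat) v : 0 <= v <= n%:R -> `|f (x + v) - f x| <= e * n%:R.
  elim: n v => [|n IH] v /andP[v0 vn].
    have -> : v = 0 by apply/eqP; rewrite eq_le vn v0.
    by rewrite addr0 subrr normr0 mulr0.
  have [v1|v1] := leP v 1.
    rewrite (le_trans (HX x v Xx _)) ?v0// ler_peMr ?(ltW e0)//.
    by rewrite ler1n.
  have vn1 : 0 <= v - 1 <= n%:R.
    by move: vn; rewrite -natr1 => vn; apply/andP; split; lra.
  have := IH _ vn1; have := HX (x + (v - 1)) 1.
  rewrite (_ : x + (v - 1) + 1 = x + v); last by ring.
  move=> H1 H2.
  rewrite (_ : f _ - f _ = (f (x + v) - f (x + (v - 1))) + (f (x + (v - 1)) - f x)); last by ring.
  rewrite (le_trans (ler_normD _ _))// -natr1 mulrDr mulr1 addrC lerD// H1 ?ler01 ?lexx//; lra.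
have [un1 un2] : u <= (Num.truncn u).+1%:R /\ (Num.truncn u)%:R <= u.
  by split; [exact/ltW/truncnS_gt|by rewrite truncn_le].
apply: le_trans (step (Num.truncn u).+1 u _) _; first by rewrite u0 un1.
by rewrite ler_pM2l// -natr1; lra.
Qed.

(** Exponential coordinates turn the multiplicative condition on [L] into vanishing increments,
    since [ln] is continuous at 1. *)
Lemma ln_slowly_varying (R : realType) (L : R -> R) :
  slowly_varying L -> (forall x, 0 < x -> 0 < L x) ->
  measurable_fun setT (fun x => ln (L (expR x))) /\
  forall u, ln (L (expR (x + u))) - ln (L (expR x)) @[x --> +oo] --> (0 : R).
Proof.
move=> [mL [_ Lslow]] L0; split.
  do 2 apply: measurableT_comp => //.
move=> u.
have Hc : L (expR u * expR x) / L (expR x) @[x --> +oo] --> (1 : R).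
  apply: (cvg_comp (@expR R) (fun y => L (expR u * y) / L y)).
    apply/cvgryPge => B; exists B; split; first exact: num_real.
    by move=> x /ltW Bx; rewrite (le_trans Bx)// (le_trans _ (expR_ge1Dx x))// lerDr.
  exact: Lslow (expR_gt0 u).
have : ln (L (expR u * expR x) / L (expR x)) @[x --> +oo] --> ln (1 : R).
  apply: (cvg_comp (fun x => L (expR u * expR x) / L (expR x)) (@ln R)).
    exact: Hc.
  exact: continuous_ln.
rewrite ln1; apply: cvg_trans; apply: near_eq_cvg; near=> x.
by rewrite /= expRD [expR x * _]mulrC ln_div// posrE L0// ?mulr_gt0 ?expR_gt0.
Unshelve. all: by end_near. Qed.

(** * Potter bounds for the normalized covariance *)

Section potter.
Context (R : realType) (RX L : R -> R) (beta : R).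
Hypotheses (RX0 : forall t, 0 < RX t) (beta_gt0 : 0 < beta) (slowL : slowly_varying L)
  (RXE : forall t, t != 0 -> RX t = L t / (`|t| `^ beta)).

(** The sublinear bound is taken at [ln (a * t)] with increment [- ln t], which ends at [ln a]; the
    power factor of [RX] contributes exactly [beta * ln t]. *)
Lemma potter_ln (e : R) : 0 < e -> exists2 A : R, 0 < A & forall a t : R, 0 < t <= 1 ->
  A <= a * t -> `|ln (RX (a * t)) - ln (RX a) + beta * ln t| <= e * (1 - ln t).
Proof.
move=> e0.
have L0 x : 0 < x -> 0 < L x.
  move=> x0; have := RX0 x; rewrite RXE ?gt_eqF// pmulr_lgt0//.
  by rewrite invr_gt0 powR_gt0// normr_gt0 gt_eqF.
have [mf fslow] := @ln_slowly_varying R L slowL L0.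
have [X HX] := @slow_increments_sublinear R _ mf fslow e e0.
exists (expR X); first exact: expR_gt0.
have lnRX y : 0 < y -> ln (RX y) = ln (L y) - beta * ln y.
  move=> y0; rewrite RXE ?gt_eqF// gtr0_norm// ln_div ?posrE ?L0 ?powR_gt0//.
  by rewrite ln_powR.
move=> a t /andP[t0 t1] Aat.
have at0 : 0 < a * t by rewrite (lt_le_trans _ Aat)// expR_gt0.
have a0 : 0 < a by move: at0; rewrite pmulr_lgt0.
have lnt : ln t <= 0 by exact: ln_le0.
have := HX (ln (a * t)) (- ln t).
rewrite -[X in X <= _]expRK ler_ln ?posrE ?expR_gt0// oppr_ge0 => /(_ Aat lnt).
rewrite [ln (a * t) - _](_ : _ = ln a); last by rewrite lnM ?posrE// addrK.
rewrite !lnK ?posrE// distrC !lnRX// lnM ?posrE//.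
congr (`|_| <= _); ring.
Qed.

(** For [a * y >= A] this is [potter_ln]. For [a * y < A], [RX (a * y)] is at most [B] and [RX a] is
    compared with [RX A]; using [potter_ln] with [e / 2] leaves a spare [e / 2] in the exponent,
    which absorbs the constant once [a / A] is large. *)
Lemma potter_upper (B e : R) : (forall t, RX t <= B) -> 0 < e ->
  exists2 a0 : R, 0 < a0 & forall a y : R, a0 <= a -> 0 < y <= 1 ->
    RX (a * y) / RX a <= expR e * y `^ (- (beta + e)).
Proof.
have beta0 := beta_gt0; move=> RXB e0; have e20 : 0 < e / 2 by rewrite divr_gt0.
have [A A0 HA] := potter_ln _ e20.
have B0 : 0 < B by exact: lt_le_trans (RX0 0) (RXB 0).
(* Chosen so that [e / 2 * s] is at least [ln B - ln (RX A)]; the condition [a >= A * expR s] says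
   that [ln (a / A) >= s]. *)
pose s := 2 / e * `|ln B - ln (RX A)|.
have s0 : 0 <= s by rewrite mulr_ge0// divr_ge0// ltW.
have aA : A <= A * expR s by rewrite ler_peMr ?(ltW A0)// -[leLHS]expR0 ler_expR.
exists (A * expR s) => [|a y Aa /andP[y0 y1]]; first by rewrite mulr_gt0 ?expR_gt0.
have a0 : 0 < a by rewrite (lt_le_trans _ Aa)// mulr_gt0 ?expR_gt0.
have lny : ln y <= 0 by exact: ln_le0.
rewrite -ler_ln ?posrE ?divr_gt0 ?mulr_gt0 ?expR_gt0 ?powR_gt0//.
rewrite ln_div ?posrE// lnM ?posrE ?expR_gt0 ?powR_gt0// expRK ln_powR.
have [Aay|ayA] := leP A (a * y).
  have := HA a y; rewrite y0 y1 => /(_ isT Aay); rewrite ler_norml => /andP[_].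
  nra.
have tA : 0 < A / a <= 1.
  by rewrite divr_gt0//= ler_pdivrMr// mul1r (le_trans aA).
have := HA a (A / a) tA; rewrite [a * _]mulrC divfK ?gt_eqF// => /(_ (lexx _)).
rewrite ln_div ?posrE// ler_norml => /andP[_].
have lnay : ln a + ln y <= ln A by rewrite -lnM ?posrE// ler_ln ?posrE ?mulr_gt0// ltW.
have lnRB : ln (RX (a * y)) <= ln B by rewrite ler_ln ?posrE.
have lnaA : ln A + s <= ln a.
  by rewrite -[s]expRK -lnM ?posrE ?expR_gt0// ler_ln ?posrE ?mulr_gt0 ?expR_gt0.
have : ln B - ln (RX A) <= e / 2 * s.
  rewrite /s mulrA (_ : e / 2 * (2 / e) = 1) ?mul1r ?ler_norm//.
  by field; rewrite gt_eqF.
have be0 : 0 <= beta + e by lra.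
have lAay : 0 <= ln A - ln a - ln y by lra.
have laAs : 0 <= ln a - ln A - s by lra.
have := mulr_ge0 be0 lAay.
have := mulr_ge0 (ltW e20) laAs.
lra.
Qed.

(** The truncation at [delta] is forced by the boundedness of the covariance near 0. For
    [a * y >= A] the error of [potter_ln] is at most [ln (1 + theta)] down to [y = delta], and
    [e < beta] makes the bound only better for smaller [y]. For [a * y < A], [RX (a * y)] stays
    above some [m > 0] while [RX a] tends to 0. *)
Lemma potter_lower (theta delta : R) :
  (forall A, exists2 m, 0 < m & forall y, 0 <= y <= A -> m <= RX y) ->
  0 < theta -> 0 < delta <= 1 ->
  exists2 a0 : R, 0 < a0 & forall a y : R, a0 <= a -> 0 <= y <= 1 ->
    Num.max y delta `^ (- beta) * RX a <= (1 + theta) * RX (a * y).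
Proof.
have beta0 := beta_gt0; move=> RXm th0 /andP[d0 d1].
have lnd : ln delta <= 0 by exact: ln_le0.
have lth : 0 < ln (1 + theta) by rewrite ln_gt0// ltrDl.
pose e := Num.min (beta / 2) (ln (1 + theta) / (1 - ln delta)).
have ld1 : 0 < 1 - ln delta by lra.
have e0 : 0 < e by rewrite lt_min !divr_gt0.
have eb : e <= beta / 2 by rewrite ge_min lexx.
have eth : e * (1 - ln delta) <= ln (1 + theta).
  by rewrite -ler_pdivlMr// ge_min lexx orbT.
have [A A0 HA] := potter_ln _ e0.
have [m m0 Hm] := RXm A.
(* [potter_ln] gives [ln (RX a) <= ln (RX A) + e - (beta - e) * ln (a / A)], so the case [a * y < A]
   amounts to making [(beta - e) * ln (a / A)] at least [D]. *)
pose D := ln (RX A) + e - ln m - beta * ln delta.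
pose s := `|D| / (beta - e).
have be0 : 0 < beta - e by lra.
have s0 : 0 <= s by rewrite divr_ge0// ltW.
have aA : A <= A * expR s by rewrite ler_peMr ?(ltW A0)// -[leLHS]expR0 ler_expR.
exists (A * expR s) => [|a y Aa /andP[y0 y1]]; first by rewrite mulr_gt0 ?expR_gt0.
have a0 : 0 < a by rewrite (lt_le_trans _ Aa)// mulr_gt0 ?expR_gt0.
have M0 : 0 < Num.max y delta by rewrite lt_max d0 orbT.
rewrite -ler_ln ?posrE ?mulr_gt0 ?powR_gt0 ?addr_gt0//.
rewrite !lnM ?posrE ?powR_gt0 ?addr_gt0// ln_powR.
have [Aay|ayA] := leP A (a * y).
  have yp : 0 < y by rewrite -(pmulr_rgt0 _ a0) (lt_le_trans A0).
  have lny : ln y <= 0 by exact: ln_le0.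
  have := HA a y; rewrite yp y1 => /(_ isT Aay); rewrite ler_norml => /andP[+ _].
  have [dy|yd] := leP delta y.
    have : ln delta <= ln y by rewrite ler_ln ?posrE.
    nra.
  have : ln y <= ln delta by rewrite ler_ln ?posrE// ltW.
  nra.
have tA : 0 < A / a <= 1.
  by rewrite divr_gt0//= ler_pdivrMr// mul1r (le_trans aA).
have := HA a (A / a) tA; rewrite [a * _]mulrC divfK ?gt_eqF// => /(_ (lexx _)).
rewrite ln_div ?posrE// ler_norml => /andP[+ _].
have lnaA : ln A + s <= ln a.
  by rewrite -[s]expRK -lnM ?posrE ?expR_gt0// ler_ln ?posrE ?mulr_gt0 ?expR_gt0.
have : D <= (beta - e) * s.
  by rewrite /s mulrCA divff ?gt_eqF// mulr1 ler_norm.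
have : ln m <= ln (RX (a * y)).
  by rewrite ler_ln ?posrE// Hm// mulr_ge0 ?(ltW a0)//= ltW.
have laAs : 0 <= ln a - ln A - s by lra.
have := mulr_ge0 (ltW be0) laAs.
have ldM : 0 <= beta * (ln (Num.max y delta) - ln delta).
  by rewrite mulr_ge0 ?(ltW beta0)// subr_ge0 ler_ln ?posrE// le_max lexx orbT.
rewrite /D; lra.
Qed.
End potter.

(** * Continuity of Gaussian covariances *)

Lemma integral_normal_prob (R : realType) (m s : R) (f : R -> \bar R) :
  (normal_prob m s).-integrable setT f ->
  (\int[normal_prob m s]_x f x =
   \int[lebesgue_measure]_x (f x * (normal_pdf m s x)%:E))%E.
Proof.
move=> intf; have dom := normal_prob_dominates m s.
rewrite -(Radon_Nikodym_change_of_variables dom)//.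
apply: ae_eq_integral => //.
- apply: emeasurable_funM; first exact: measurable_int intf.
  by apply: (@measurable_int _ _ _ lebesgue_measure); exact: Radon_Nikodym_integrable.
- apply: emeasurable_funM; first exact: measurable_int intf.
  by apply/measurable_EFinP; exact: measurable_normal_pdf.
- apply: ae_eqe_mul2l => /=.
  rewrite Radon_NikodymE//=; case: cid => /= h [h1 h2 h3].
  apply: integral_ae_eq => //=.
    by apply/measurable_EFinP; exact: measurable_normal_pdf.
  by move=> E _ mE; rewrite -h3.
Qed.

(* [t <= exp t] turns [y^2 exp (- y^2 / 2 s^2)] into a multiple of
   [exp (- y^2 / 2 (2 s)^2)], the density of the normal law of deviation [2 s]. *)
Lemma sqr_normal_pdf_le (R : realType) (s y : R) : 0 < s ->
  y ^+ 2 * normal_pdf 0 s y <= 6 * s ^+ 2 * normal_pdf 0 (2 * s) y.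
Proof.
move=> s0; have s20 : 0 < s ^+ 2 by rewrite exprn_gt0.
have s2 : 2 * s != 0 by rewrite gt_eqF// mulr_gt0.
rewrite !normal_pdfE ?gt_eqF//; last by rewrite mulr_gt0.
rewrite /normal_fun subr0.
have -> : normal_peak s = 2 * normal_peak (2 * s).
  rewrite /normal_peak (_ : (2 * s) ^+ 2 * pi *+ 2 = 2 ^+ 2 * (s ^+ 2 * pi *+ 2)); last first.
    by ring.
  by rewrite sqrtrM ?sqr_ge0// sqrtr_sqr ger0_norm// invfM mulrA divff ?mul1r.
set t := y ^+ 2 / (s ^+ 2).
have t0 : 0 <= t by rewrite divr_ge0 ?sqr_ge0// ltW.
have -> : y ^+ 2 = s ^+ 2 * t by rewrite /t mulrC divfK// gt_eqF.
rewrite (_ : - (s ^+ 2 * t) / (s ^+ 2 *+ 2) = - (3 / 8 * t) + - (t / 8)); last first.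
  by rewrite -mulr_natr; field; rewrite gt_eqF.
rewrite (_ : - (s ^+ 2 * t) / ((2 * s) ^+ 2 *+ 2) = - (t / 8)); last first.
  by rewrite -mulr_natr exprMn; field; rewrite gt_eqF.
rewrite expRD.
(* From [1 + x <= exp x] at [x = 3 t / 8]; the peak ratio 2 times [8 / 3] is below the factor 6. *)
have H : t * expR (- (3 / 8 * t)) <= 8 / 3.
  rewrite expRN ler_pdivrMr ?expR_gt0//.
  have := expR_ge1Dx (3 / 8 * t); lra.
set pk := normal_peak _; set ee := expR (- (t / 8)).
have pe : 0 <= s ^+ 2 * pk * ee.
  by rewrite !mulr_ge0 ?expR_ge0 ?normal_peak_ge0// ltW.
set e3 := expR _ in H *.
rewrite (_ : s ^+ 2 * t * _ = 2 * (t * e3) * (s ^+ 2 * pk * ee)); last by ring.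
rewrite (_ : 6 * s ^+ 2 * _ = 6 * (s ^+ 2 * pk * ee)); last by ring.
by rewrite ler_wpM2r//; lra.
Qed.

(** The crude factor 6 avoids computing the moment: the pointwise bound is integrated against a
    density of mass 1. It suffices for bounding [s] from below by the second moment. *)
Lemma normal_second_moment_le (R : realType) (s : R) : 0 < s ->
  (normal_prob 0 s).-integrable setT (fun y => (y ^+ 2)%:E) ->
  (\int[normal_prob 0 s]_y (y ^+ 2)%:E <= (6 * s ^+ 2)%:E)%E.
Proof.
move=> s0 /integral_normal_prob ->.
have c0 : 0 <= 6 * s ^+ 2 by rewrite mulr_ge0// sqr_ge0.
rewrite -[leRHS]mule1 -(integral_normal_pdf 0 (2 * s)) -ge0_integralZl_EFin//=.
- apply: ge0_le_integral => //=.
  + by move=> x _; rewrite -EFinM lee_fin mulr_ge0 ?sqr_ge0// normal_pdf_ge0.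
  + apply: emeasurable_funM; first by apply/measurable_EFinP; exact: exprn_measurable.
    by apply/measurable_EFinP; exact: measurable_normal_pdf.
  + apply: emeasurable_funM => //.
    by apply/measurable_EFinP; exact: measurable_normal_pdf.
  + by move=> x _; rewrite -!EFinM lee_fin sqr_normal_pdf_le.
- by move=> x _; rewrite lee_fin normal_pdf_ge0.
- by apply/measurable_EFinP; exact: measurable_normal_pdf.
Qed.

Lemma normal_prob_ball_le (R : realType) (s r : R) : 0 < s -> 0 < r ->
  (normal_prob 0 s [set` `]-r, r[%R] <= (2 * r * normal_peak s)%:E)%E.
Proof.
move=> s0 r0; rewrite /normal_prob.
apply: (@le_trans _ _ (\int[lebesgue_measure]_(x in [set` `]- r, r[%R]) (normal_peak s)%:E)%E).
  apply: ge0_le_integral => //=.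
  - by move=> x _; rewrite lee_fin normal_pdf_ge0.
  - by apply/measurable_EFinP/measurable_funTS; exact: measurable_normal_pdf.
  - by move=> x _; rewrite lee_fin normal_pdf_ub// gt_eqF.
rewrite integral_cst//= lebesgue_measure_itv/= lte_fin gtrN//.
rewrite -?EFinN -EFinD -EFinM lee_fin opprK.
by rewrite [leRHS](_ : _ = normal_peak s * (r + r)) //; ring.
Qed.

Section gaussian.
Context d (T : measurableType d) (R : realType) (P : probability T R).

Lemma integral_law d' (T' : measurableType d') (Y : T -> T')
    (m : {measure set T' -> \bar R}) (f : T' -> \bar R) :
  measurable_fun setT Y -> (forall A, measurable A -> P (Y @^-1` A) = m A) ->
  measurable_fun setT f -> (forall y, 0 <= f y)%E ->
  (\int[P]_w f (Y w) = \int[m]_y f y)%E.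
Proof.
move=> mY lawY mf f0.
pose Y' : {mfun T >-> T'} := HB.pack Y (isMeasurableFun.Build _ _ _ _ _ mY).
rewrite -[LHS](@ge0_integral_distribution _ _ T T' R P Y')//.
by apply: eq_measure_integral => A mA _; exact: lawY.
Qed.

(** The radius depends on [c] only. A second moment at least [c] excludes the degenerate law and
    forces [s ^+ 2 >= c / 6], which bounds the density. *)
Lemma gaussian_small_ball (c : R) : 0 < c -> exists2 r : R, 0 < r &
  forall Y : T -> R, measurable_fun setT Y -> centered_gaussian P Y ->
    (c%:E <= \int[P]_w (Y w ^+ 2)%:E < +oo)%E ->
    (P (Y @^-1` [set` `]-r, r[%R]) <= (1 / 2)%:E)%E.
Proof.
(* [q^-1] is the density peak when [s ^+ 2 = c / 6], so a ball of radius [q / 4] has mass at most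
   [2 * (q / 4) / q = 1 / 2]. *)
move=> c0; pose q := Num.sqrt (c / 6 * pi *+ 2).
have q0 : 0 < q by rewrite sqrtr_gt0 pmulrn_lgt0// mulr_gt0 ?divr_gt0// pi_gt0.
have r0 : 0 < q / 4 by rewrite divr_gt0.
have m2 : measurable_fun setT (fun y : R => (y ^+ 2)%:E).
  by apply/measurable_EFinP; exact: exprn_measurable.
exists (q / 4) => // Y mY [s [[_ lawY]|[s0 lawY]]] /andP[cY Yoo].
  have := cY; rewrite (@integral_law _ R Y (\d_(0:R)) (fun y => (y ^+ 2)%:E))//; last first.
    by move=> y; rewrite lee_fin sqr_ge0.
  by rewrite integral_dirac// expr2 mul0r mule0 lee_fin leNgt c0.
have EY : (\int[P]_w (Y w ^+ 2)%:E = \int[normal_prob 0 s]_y (y ^+ 2)%:E)%E.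
  rewrite (@integral_law _ (measurableTypeR R) Y (normal_prob 0 s) (fun y => (y ^+ 2)%:E))//.
  by move=> y; rewrite lee_fin sqr_ge0.
have int2 : (normal_prob 0 s).-integrable setT (fun y => (y ^+ 2)%:E).
  apply/integrableP; split => //; under eq_integral do rewrite gee0_abs ?lee_fin ?sqr_ge0//.
  by rewrite -EY.
have cs : c / 6 <= s ^+ 2.
  have := le_trans cY; rewrite EY => /(_ _ (@normal_second_moment_le _ _ s0 int2)).
  by rewrite lee_fin; lra.
rewrite lawY//; apply: le_trans (@normal_prob_ball_le _ _ _ s0 r0) _.
rewrite lee_fin /normal_peak ler_pdivrMr; last first.
  by rewrite sqrtr_gt0 pmulrn_lgt0// mulr_gt0 ?exprn_gt0// pi_gt0.
have : q <= Num.sqrt (s ^+ 2 * pi *+ 2).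
  by rewrite ler_wsqrtr// lerMn2r/= ler_wpM2r// ltW// pi_gt0.
lra.
Qed.
End gaussian.

Section stationary_covariance.
Context d (T : measurableType d) (R : realType) (P : probability T R)
  (X : R -> T -> R) (K : R -> R).
Hypotheses (mX : forall t, measurable_fun setT (X t))
  (covX : forall s t, (\int[P]_w (X s w * X t w)%:E)%E = (K (t - s))%:E).

Lemma integrable_process_prod s t :
  P.-integrable setT (fun w => (X s w * X t w)%:E).
Proof.
have mXX u v : measurable_fun setT (fun w => (X u w * X v w)%:E).
  by apply/measurable_EFinP; exact: measurable_funM.
have intsq u : P.-integrable setT (fun w => (X u w * X u w)%:E).
  apply/integrableP; split => //.
  under eq_integral do rewrite gee0_abs ?lee_fin -?expr2 ?sqr_ge0// expr2.
  by rewrite covX ltry.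
apply: (@le_integrable _ _ _ P _ _ _ (fun w => (X s w * X s w)%:E + (X t w * X t w)%:E)%E) => //.
- move=> w _; rewrite -EFinD /= lee_fin [leRHS]ger0_norm; last first.
    by rewrite addr_ge0// -expr2 sqr_ge0.
  rewrite ler_norml; have := sqr_ge0 (X s w + X t w); have := sqr_ge0 (X s w - X t w).
  by rewrite sqrrB sqrrD !expr2; have := sqr_ge0 (X s w); have := sqr_ge0 (X t w);
    rewrite !expr2; lra.
- exact: integrableD.
Qed.

Lemma covariance_quadratic_form n (t c : 'I_n -> R) :
  (\int[P]_w ((\sum_(i < n) c i * X (t i) w) ^+ 2)%:E =
   (\sum_(i < n) \sum_(j < n) c i * c j * K (t j - t i))%:E)%E.
Proof.
transitivity (\int[P]_w (\sum_(i < n) \sum_(j < n)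
    (c i * c j)%:E * (X (t i) w * X (t j) w)%:E))%E.
  apply: eq_integral => w _; rewrite expr2 mulr_suml -sumEFin; apply: eq_bigr => i _.
  rewrite mulr_sumr -sumEFin; apply: eq_bigr => j _.
  by rewrite -EFinM; congr EFin; ring.
rewrite integral_sum//; last first.
  move=> i; apply: integrable_sum => // j _; apply: integrableZl => //.
  exact: integrable_process_prod.
rewrite -sumEFin; apply: eq_bigr => i _; rewrite integral_sum//; last first.
  by move=> j; apply: integrableZl => //; exact: integrable_process_prod.
rewrite -sumEFin; apply: eq_bigr => j _; rewrite integralZl//.
  by rewrite covX EFinM.
exact: integrable_process_prod.
Qed.

Lemma covariance_even t : K (- t) = K t.
Proof.
apply: EFin_inj; have := covX t 0; have := covX 0 t; rewrite sub0r subr0 => <- <-.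
by apply: eq_integral => w _; rewrite mulrC.
Qed.

(** Three points suffice for the bound by [K 0], for the transfer of continuity from 0, and, with a
    zero coefficient, for the variance of an increment. *)
Lemma covariance_form3 (a b c r s t : R) :
  (\int[P]_w ((a * X r w + b * X s w + c * X t w) ^+ 2)%:E =
  ((a ^+ 2 + b ^+ 2 + c ^+ 2) * K 0 + 2 * a * b * K (s - r) + 2 * a * c * K (t - r)
    + 2 * b * c * K (t - s))%:E)%E.
Proof.
pose tt (i : 'I_3) := [:: r; s; t]`_i; pose cc (i : 'I_3) := [:: a; b; c]`_i.
have := covariance_quadratic_form 3%N tt cc.
under eq_integral do rewrite !big_ord_recl big_ord0 /tt /cc /= addr0 addrA.
move=> ->; congr EFin; rewrite !big_ord_recl !big_ord0 /tt /cc /= !subrr.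
rewrite -(covariance_even (s - r)) -(covariance_even (t - r)) -(covariance_even (t - s)).
by rewrite !opprB; ring.
Qed.

Lemma covariance_form3_ge0 (a b c r s t : R) :
  0 <= (a ^+ 2 + b ^+ 2 + c ^+ 2) * K 0 + 2 * a * b * K (s - r) + 2 * a * c * K (t - r)
    + 2 * b * c * K (t - s).
Proof.
by rewrite -lee_fin -covariance_form3; apply: integral_ge0 => w _; rewrite lee_fin sqr_ge0.
Qed.

Lemma covariance_le0 t : K t <= K 0.
Proof.
have := covariance_form3_ge0 1 (-1) 0 0 t 0; rewrite !subr0; lra.
Qed.

(** Positivity of the form with coefficients [l], [1], [-1] and [-l], [1], [-1] at the points [0],
    [s], [t] bounds [2 l |K s - K t|] by [l^2 K 0 + 2 (K 0 - K (s - t))]. With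
    [K 0 - K (s - t) < l^2], dividing by [l] leaves [l (K 0 + 2) = e]. *)
Lemma covariance_continuous_of_0 :
  (forall e : R, 0 < e -> exists2 r : R, 0 < r & forall h : R, `|h| < r -> K 0 - K h < e) ->
  continuous K.
Proof.
move=> K0 t; apply/cvgrPdist_lt => e e0.
pose l := e / (K 0 + 2).
have K00 : 0 <= K 0 by have := covariance_form3_ge0 1 0 0 0 0 0; rewrite !subr0; lra.
have l0 : 0 < l by rewrite divr_gt0//; lra.
have l20 : 0 < l ^+ 2 by rewrite exprn_gt0.
have [r r0 Hr] := K0 _ l20.
exists r => //= s /=; rewrite distrC => /Hr Ks.
have lE : l * (K 0 + 2) = e by rewrite /l divfK// gt_eqF//; lra.
have := covariance_form3_ge0 l 1 (-1) 0 s t; have := covariance_form3_ge0 (- l) 1 (-1) 0 s t.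
rewrite -[K (t - s)]covariance_even opprB !subr0 ltr_norml => H1 H2.
have : 2 * (l * (K s - K t)) <= l * (l * K 0 + 2 * l).
  by lra.
have : 2 * (l * (K t - K s)) <= l * (l * K 0 + 2 * l).
  by lra.
rewrite ![2 * (l * _)]mulrCA !ler_pM2l// => H3 H4.
have : l * K 0 + 2 * l = e by rewrite -lE; ring.
lra.
Qed.
End stationary_covariance.

(** Otherwise some [h n] tending to 0 give increments of variance at least [2 * e], each lying in a
    fixed ball with probability at most 1/2. Path continuity at 0 puts every sample point eventually
    in that ball, so these probabilities eventually exceed 1/2. *)
Lemma gaussian_covariance_continuous d (T : measurableType d) (R : realType)
    (P : probability T R) (X : R -> T -> R) (K : R -> R) :
  centered_gaussian_process P X ->
  (forall s t, (\int[P]_w (X s w * X t w)%:E)%E = (K (t - s))%:E) ->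
  (forall w, continuous (fun t => X t w)) -> continuous K.
Proof.
move=> [mX gX] covX cX; apply: (covariance_continuous_of_0 _ _ _ _ _ _ mX covX) => e e0.
have e20 : 0 < 2 * e by rewrite mulr_gt0.
apply: contrapT => H.
have {}H n : exists h : R, `|h| < n.+1%:R^-1 /\ e <= K 0 - K h.
  apply: contrapT => /forallNP Hn; apply: H; exists n.+1%:R^-1; first by rewrite invr_gt0.
  by move=> h hn; have /not_andP[//|/negP] := Hn h; rewrite -ltNge.
have /choice[h Hh] := H.
pose Y n w := 1 * X 0 w + (-1) * X (h n) w + 0 * X 0 w.
have mY n : measurable_fun setT (Y n).
  by apply: measurable_funD; [apply: measurable_funD|]; apply: measurable_funM => //;
    exact: mX.
have [r r0 Hr] := @gaussian_small_ball _ T R P _ e20.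
have small n : (P (Y n @^-1` [set` `]-r, r[%R]) <= (1 / 2)%:E)%E.
  apply: Hr => //.
    pose tt (i : 'I_3) := [:: 0; h n; 0]`_i; pose cc (i : 'I_3) := [:: 1; -1; (0 : R)]`_i.
    have := gX 3%N tt cc; congr centered_gaussian; apply/funext => w.
    by rewrite !big_ord_recl big_ord0 /tt /cc /= addr0 addrA.
  rewrite (covariance_form3 _ _ _ _ _ _ mX covX) ltry andbT lee_fin !subr0.
  have [_] := Hh n; lra.
pose F n := \bigcap_(m in [set m | (n <= m)%N]) (Y m @^-1` [set` `]-r, r[%R]).
have mF n : measurable (F n).
  apply: bigcap_measurable; first by exists n => /=.
  by move=> m _; rewrite -[X in measurable X]setTI; exact: mY.
have [||||N] := @measure_exhaust _ T R P F setT (1 / 2)%:E mF.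
- by move=> n m nm; apply/subsetPset => w H' k /= mk; apply: H' => /=; exact: leq_trans mk.
- exact: measurableT.
- move=> w _.
  have /cvgrPdist_lt/(_ _ r0)[q /= q0 Hq] := cX w 0.
  have [N Nq] : exists N : nat, N.+1%:R^-1 < q.
    exists (Num.truncn q^-1); rewrite invf_plt ?posrE//; exact: truncnS_gt.
  exists N => // m /= Nm; rewrite in_itv/= -ltr_norml /Y mul1r mulN1r mul0r addr0.
  apply: Hq; rewrite /ball/= sub0r normrN.
  have [hm _] := Hh m; rewrite (lt_trans hm)// (le_lt_trans _ Nq)//.
  by rewrite lef_pV2 ?posrE// ler_nat.
- apply: (@lt_le_trans _ _ 1%E); first by rewrite lte_fin; lra.
  by rewrite -[leLHS](@probability_setT _ _ _ P); exact: lexx.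
- move=> /(_ N (leqnn _)); apply/negP; rewrite -leNgt.
  apply: le_trans (small N); apply: le_measure; rewrite ?inE//.
    by rewrite -[X in measurable X]setTI; exact: mY.
  by move=> w; apply => /=.
Qed.

Lemma continuous_positive_lbound (R : realType) (K : R -> R) (A : R) :
  continuous K -> (forall t, 0 < K t) ->
  exists2 m, 0 < m & forall y, 0 <= y <= A -> m <= K y.
Proof.
move=> cK K0; have [A0|A0] := leP 0 A; last first.
  by exists 1 => // y /andP[y0 yA]; have := le_lt_trans (le_trans y0 yA) A0; rewrite ltxx.
have [|c _ Hc] := @EVT_min R K 0 A A0; first exact: continuous_subspaceT.
by exists (K c) => // y y0A; apply: Hc; rewrite in_itv.
Qed.

(** * Energies and smoothing *)

(* The library's uniform law lives on [measurableTypeR R]; this transports it to [R]. *)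
Definition measurableTypeR_id (R : realType) : measurableTypeR R -> R := id.

Lemma measurable_measurableTypeR_id (R : realType) :
  measurable_fun setT (measurableTypeR_id R).
Proof. by move=> _ A mA; rewrite setTI. Qed.

HB.instance Definition _ (R : realType) :=
  isMeasurableFun.Build _ _ _ _ (measurableTypeR_id R) (measurable_measurableTypeR_id R).

Definition unif01 (R : realType) : probability R R :=
  distribution (uniform_prob (@ltr01 R)) (measurableTypeR_id R).

(** A convex combination, rather than a sum with small noise, keeps the smoothed law on [[0, 1]]. *)
Definition smooth_map (R : realType) (eta : R) (z : R * R) : R :=
  (1 - eta) * z.1 + eta * z.2.

Lemma measurable_smooth_map (R : realType) (eta : R) :
  measurable_fun setT (smooth_map R eta).
Proof.
by apply: measurable_funD; apply: measurable_funM => //; exact: measurable_cst.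
Qed.

HB.instance Definition _ (R : realType) (eta : R) :=
  isMeasurableFun.Build _ _ _ _ (smooth_map R eta) (measurable_smooth_map R eta).

Definition smooth (R : realType) (eta : R) (mu : probability R R) : probability R R :=
  distribution (mu \x unif01 R)%E (smooth_map R eta).

Lemma integral_unif01 (R : realType) (f : R -> \bar R) :
  measurable_fun setT f -> (forall x, 0 <= f x)%E ->
  (\int[unif01 R]_x f x = \int[lebesgue_measure]_(x in `[0%R, 1%R]) f x)%E.
Proof.
by move=> mf f0; rewrite ge0_integral_distribution// integral_uniform// subr0 invr1 mul1e.
Qed.

Section energy.
Context (R : realType).
Implicit Types (mu : probability R R) (K : R -> R -> \bar R).

(** Bridges [energy], which integrates over [[0, 1]], and the Tonelli theorem, applied on the whole
    line. *)
Lemma integral_full_measure mu (A : set R) (f : R -> \bar R) :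
  measurable A -> mu A = 1%E -> measurable_fun setT f -> (forall x, 0 <= f x)%E ->
  (\int[mu]_(x in A) f x = \int[mu]_x f x)%E.
Proof.
move=> mA A1 mf f0.
rewrite [RHS](@ge0_negligible_integral _ _ _ mu setT (~` A))//.
- by rewrite setDE setCK setTI.
- exact: measurableC.
- by have := @probability_setC _ _ _ mu A mA; rewrite A1 subee.
Qed.

Definition kernel_measurable K := measurable_fun setT (fun z : R * R => K z.1 z.2).

Lemma kernel_measurable_l K v : kernel_measurable K -> measurable_fun setT (K ^~ v).
Proof.
move=> mK; apply: (measurableT_comp (f := fun z : R * R => K z.1 z.2) (g := fun u => (u, v))) => //.
Qed.

Lemma measurable_integral_kernel mu K :
  kernel_measurable K -> (forall u v, 0 <= K u v)%E ->
  measurable_fun setT (fun v => \int[mu]_u K u v)%E.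
Proof.
move=> mK K0.
by apply: (@measurable_fun_fubini_tonelli_G _ _ R R R mu (fun z => K z.1 z.2)).
Qed.

Lemma energyE mu K : mu \in prob01 -> kernel_measurable K -> (forall u v, 0 <= K u v)%E ->
  energy mu K = (\int[mu]_v \int[mu]_u K u v)%E.
Proof.
move=> /set_mem mu1 mK K0; rewrite /energy.
transitivity (\int[mu]_(v in `[0%R, 1%R]) \int[mu]_u K u v)%E.
  apply: eq_integral => v _; apply: integral_full_measure => //.
  exact: kernel_measurable_l.
apply: integral_full_measure => //; first exact: measurable_integral_kernel.
by move=> v; apply: integral_ge0.
Qed.

Lemma measurable_integral_kernel01 mu K :
  kernel_measurable K -> (forall u v, 0 <= K u v)%E -> mu \in prob01 ->
  measurable_fun setT (fun v => \int[mu]_(u in `[0%R, 1%R]) K u v)%E.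
Proof.
move=> mK K0 /set_mem mu1.
have -> : (fun v => \int[mu]_(u in `[0%R, 1%R]) K u v)%E = (fun v => \int[mu]_u K u v)%E.
  apply/funext => v; apply: integral_full_measure => //; exact: kernel_measurable_l.
exact: measurable_integral_kernel.
Qed.

Lemma energy_le mu K K' : mu \in prob01 ->
  kernel_measurable K -> (forall u v, 0 <= K u v)%E ->
  kernel_measurable K' -> (forall u v, 0 <= K' u v)%E ->
  (forall u v : R, 0 <= u <= 1 -> 0 <= v <= 1 -> (K u v <= K' u v)%E) ->
  (energy mu K <= energy mu K')%E.
Proof.
move=> mu1 mK K0 mK' K'0 KK'; apply: ge0_le_integral => //.
- by move=> v _; apply: integral_ge0.
- by apply: measurable_funTS; exact: measurable_integral_kernel01.
- by apply: measurable_funTS; exact: measurable_integral_kernel01.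
move=> v /= v01; apply: ge0_le_integral => //.
- by apply: measurable_funTS; exact: kernel_measurable_l.
- by apply: measurable_funTS; exact: kernel_measurable_l.
- by move=> u /= u01; apply: KK'; [move: u01|move: v01]; rewrite in_itv.
Qed.

Lemma energyZ mu K (c : R) : mu \in prob01 -> 0 <= c ->
  kernel_measurable K -> (forall u v, 0 <= K u v)%E ->
  energy mu (fun u v => c%:E * K u v)%E = (c%:E * energy mu K)%E.
Proof.
move=> mu1 c0 mK K0; rewrite /energy -ge0_integralZl_EFin//.
- apply: eq_integral => v _; rewrite ge0_integralZl_EFin//.
  by apply: measurable_funTS; exact: kernel_measurable_l.
- by move=> v _; apply: integral_ge0.
- by apply: measurable_funTS; exact: measurable_integral_kernel01.
Qed.

Lemma energy_sum mu (I : finType) (K : I -> R -> R -> \bar R) : mu \in prob01 ->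
  (forall i, kernel_measurable (K i)) -> (forall i u v, 0 <= K i u v)%E ->
  energy mu (fun u v => \sum_i K i u v)%E = (\sum_i energy mu (K i))%E.
Proof.
move=> mu1 mK K0; rewrite /energy -ge0_integral_sum//.
- apply: eq_integral => v _; rewrite ge0_integral_sum//.
  by move=> i; by apply: measurable_funTS; exact: kernel_measurable_l.
- by move=> i; by apply: measurable_funTS; exact: measurable_integral_kernel01.
- by move=> i v _; apply: integral_ge0.
Qed.

Lemma prob01_smooth (eta : R) mu : 0 <= eta <= 1 -> mu \in prob01 ->
  smooth R eta mu \in prob01.
Proof.
move=> /andP[e0 e1] /set_mem mu1; apply/mem_set; rewrite /prob01/=.
have U1 : unif01 R `[0%R, 1%R]%classic = 1%E.
  exact: (@integral_uniform_pdf1 R 0 1 `[0%R, 1%R]%classic (@ltr01 R)).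
have mS : measurable (smooth_map R eta @^-1` `[0%R, 1%R]%classic).
  by rewrite -[X in measurable X]setTI; exact: measurable_smooth_map.
apply/eqP; rewrite eq_le probability_le1//=.
rewrite /distribution /pushforward.
apply: (@le_trans _ _ ((mu \x unif01 R)%E (`[0%R, 1%R]%classic `*` `[0%R, 1%R]%classic))).
  rewrite [leRHS](_ : _ = mu `[0%R, 1%R]%classic * unif01 R `[0%R, 1%R]%classic)%E; last first.
    exact: product_measure1E.
  by rewrite mu1 U1 mule1.
apply: le_measure; rewrite ?inE.
- exact: measurableX.
- exact: mS.
- move=> [x s] [/=]; rewrite !in_itv/= /smooth_map/= => /andP[x0 x1] /andP[s0 s1].
  by apply/andP; split; nra.
Qed.

(** By Tonelli the smoothed energy is a fourfold integral. Averaging over the single noise variable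
    [s] already gives [g x x'], uniformly in the other one [s']. *)
Lemma energy_smooth_le (eta : R) mu K (g : R -> R -> \bar R) : 0 <= eta <= 1 -> mu \in prob01 ->
  kernel_measurable K -> (forall u v, 0 <= K u v)%E ->
  kernel_measurable g -> (forall u v, 0 <= g u v)%E ->
  (forall x x' s' : R, 0 <= x <= 1 -> 0 <= x' <= 1 -> 0 <= s' <= 1 ->
    (\int[lebesgue_measure]_(s in `[0%R, 1%R])
      K (smooth_map R eta (x, s)) (smooth_map R eta (x', s')) <= g x x')%E) ->
  (energy (smooth R eta mu) K <= energy mu g)%E.
Proof.
move=> eta01 mu1 mK K0 mg g0 Kg; rewrite energyE//; last exact: prob01_smooth.
have mu01 := set_mem mu1.
pose H z' := (\int[mu]_x \int[unif01 R]_s K (smooth_map R eta (x, s)) (smooth_map R eta z'))%E.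
have mK1 v : measurable_fun setT (fun z : R * R => K (smooth_map R eta z) v).
  apply: (measurableT_comp (f := K ^~ v)); first exact: kernel_measurable_l.
  exact: measurable_smooth_map.
have HE z' : (\int[smooth R eta mu]_u K u (smooth_map R eta z'))%E = H z'.
  rewrite ge0_integral_distribution//; last exact: kernel_measurable_l.
  by rewrite (fubini_tonelli1 (fun z => K (smooth_map R eta z) (smooth_map R eta z'))).
have mI := @measurable_integral_kernel (smooth R eta mu) K mK K0.
have mH : measurable_fun setT H.
  rewrite (_ : H = (fun z' => \int[smooth R eta mu]_u K u (smooth_map R eta z'))%E); last first.
    by apply/funext => z'; rewrite HE.
  apply: (measurableT_comp mI); exact: measurable_smooth_map.
have H0 z' : (0 <= H z')%E by do 2 (apply: integral_ge0 => ? _).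
rewrite ge0_integral_distribution//; last by move=> v; apply: integral_ge0.
rewrite (eq_integral H); last by move=> z' _; rewrite -HE.
rewrite fubini_tonelli1// /fubini_F /energy.
rewrite -(@integral_full_measure mu `[0%R, 1%R]%classic)//; last 2 first.
- exact: measurable_fun_fubini_tonelli_F.
- by move=> x; apply: integral_ge0.
apply: ge0_le_integral => //.
- by move=> x _; apply: integral_ge0.
- by apply: measurable_funTS; exact: measurable_fun_fubini_tonelli_F.
- by apply: measurable_funTS; exact: measurable_integral_kernel01.
move=> x' /= x'01; rewrite integral_unif01//; last first.
  exact: (measurableT_comp mH).
set G := (X in (_ <= X)%E).
have G0 : (0 <= G)%E by apply: integral_ge0.
(* [G] is free of [s'], so integrating it over [[0, 1]] returns [G]. *)
apply: (@le_trans _ _ (\int[lebesgue_measure]_(s' in `[0%R, 1%R]) G)%E); last first.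
  by rewrite integral_cst//= lebesgue_measure_itv/= lte01 oppr0 adde0 mule1.
apply: ge0_le_integral => //.
- by apply: measurable_funTS; exact: (measurableT_comp mH).
move=> s' /= s'01; rewrite /H /G.
rewrite -(@integral_full_measure mu `[0%R, 1%R]%classic)//; last 2 first.
- exact: (measurable_fun_fubini_tonelli_F (fun z => K (smooth_map R eta z) _)).
- by move=> x; apply: integral_ge0.
apply: ge0_le_integral => //.
- by move=> x _; apply: integral_ge0.
- apply: measurable_funTS.
  exact: (measurable_fun_fubini_tonelli_F (fun z => K (smooth_map R eta z) _)).
- by apply: measurable_funTS; exact: kernel_measurable_l.
move=> x /= x01; rewrite integral_unif01//; last exact: (measurableT_comp (mK1 _)).
by apply: Kg; [move: x01|move: x'01|move: s'01]; rewrite in_itv.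
Qed.
End energy.

(** * Riesz kernels averaged over a uniform variable *)

Lemma le_powRN (R : realType) (g a b : R) : 0 <= g -> 0 < a -> a <= b ->
  b `^ (- g) <= a `^ (- g).
Proof.
move=> g0 a0 ab; have b0 := lt_le_trans a0 ab.
rewrite !powRN lef_pV2 ?posrE ?powR_gt0//.
by apply: ge0_ler_powR => //; rewrite nnegrE ltW.
Qed.

Lemma powRN_le1 (R : realType) (g t : R) : 0 <= g -> 1 <= t -> t `^ (- g) <= 1.
Proof. by move=> g0 t1; have := le_powRN R g 1 t g0 ltr01 t1; rewrite powR1. Qed.

Lemma riesz_kernel_ge0 (R : realType) (g : R) u v : (0 <= riesz_kernel g u v)%E.
Proof. by rewrite /riesz_kernel; case: ifP => // _; rewrite lee_fin powR_ge0. Qed.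

Lemma measurable_riesz_kernel (R : realType) (g : R) :
  kernel_measurable R (riesz_kernel g).
Proof.
rewrite /kernel_measurable /riesz_kernel; apply: measurable_fun_ifT => /=.
- by apply: measurable_fun_eqr.
- exact: measurable_cst.
- apply/measurable_EFinP; apply: (measurableT_comp (@measurable_powR R (- g))).
  by apply: measurableT_comp => //; apply: measurable_funB.
Qed.

(** If [2^-(k+1) <= t < 2^-k], the term of index [k] alone dominates [t^-g]. The power is thus
    bounded by weighted indicators of dyadic balls. *)
Lemma powRN_le_dyadic (R : realType) (g t : R) n : 0 <= g -> (2^-1) ^+ n <= t ->
  t `^ (- g) <= 1 + \sum_(k < n) (2 `^ g) ^+ k.+1 * (t < (2^-1) ^+ k)%R%:R.
Proof.
move=> g0; have p0 : 0 <= 2 `^ g :> R by exact: powR_ge0.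
elim: n => [|n IH] nt; first by rewrite big_ord0 addr0 powRN_le1.
rewrite big_ord_recr/= addrA; have [tn|tn] := ltP t ((2^-1) ^+ n); last first.
  by rewrite mulr0 addr0 IH.
rewrite mulr1 (le_trans (@le_powRN _ _ _ _ g0 _ nt))//.
rewrite exprVn -powR_invn// -powRrM mulrNN mulrC powRrM powR_mulrn//.
by rewrite lerDr addr_ge0// sumr_ge0.
Qed.

(** The ball of radius [2^-k] has measure [2 * 2^-k] whatever its centre, so the dyadic bound
    integrates to a geometric series of ratio [2^g / 2 < 1], uniformly in [w]. *)
Lemma integral_riesz_le (R : realType) (g : R) : 0 < g < 1 ->
  exists2 C : R, 0 < C & forall w : R,
    (\int[lebesgue_measure]_(s in `[0%R, 1%R]) riesz_kernel g s w <= C%:E)%E.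
Proof.
move=> /andP[g0 g1]; pose p : R := 2 `^ g.
have p0 : 0 < p by exact: powR_gt0.
have p2 : p < 2.
  by rewrite -[ltRHS]powRr1// /p /powR pnatr_eq0/= ltr_expR ltr_pM2r// ln_gt0// ltr1n.
have q1 : 0 < 1 - p / 2 by rewrite subr_gt0 ltr_pdivrMr// mul1r.
exists (1 + 2 * p / (1 - p / 2)); first by rewrite addr_gt0// divr_gt0// mulr_gt0.
move=> w; pose D : set R := `[0, 1]%classic.
(* The dyadic bound with [n] terms holds on [F n]; these sets exhaust [D] up to the null set
   [[set w]], where the kernel is infinite. *)
pose F n := D `&` [set s | (2^-1) ^+ n <= `|s - w|].
have mf : measurable_fun setT (riesz_kernel g ^~ w).
  by apply: kernel_measurable_l; exact: measurable_riesz_kernel.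
have mF n : measurable (F n).
  apply: measurableI; first exact: measurable_itv.
  have : measurable_fun setT (fun s : R => `|s - w|).
    by apply: measurableT_comp => //; apply: measurable_funB.
  move=> /(_ measurableT _ (measurable_itv `[(2^-1) ^+ n, +oo[)).
  by rewrite setTI; congr measurable; apply/seteqP; split => s /=; rewrite in_itv/= andbT.
rewrite [leLHS](_ : _ = (\int[lebesgue_measure]_(s in D `\` [set w]) riesz_kernel g s w)%E);
    last first.
  apply: ge0_negligible_integral => //.
  - exact: measurable_funTS.
  - by move=> s _; exact: riesz_kernel_ge0.
  - exact: lebesgue_measure_set1.
have -> : D `\` [set w] = \bigcup_n F n.
  apply/seteqP; split => [s [sD sw]|s [n _ [sD]] /=].
    have sw0 : 0 < `|s - w| by rewrite normr_gt0 subr_eq0; exact/eqP.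
    have [n Hn] : exists n, (2^-1) ^+ n < `|s - w|.
      have : (2^-1 : R) ^+ n @[n --> \oo] --> (0 : R).
        by apply: cvg_expr; rewrite ger0_norm// invf_lt1// ltr1n.
      move=> /cvgrPdist_lt/(_ _ sw0)[N _ HN]; exists N.
      by have := HN N (leqnn N); rewrite /= sub0r normrN ger0_norm// exprn_ge0.
    by exists n => //; split => //=; exact: ltW.
  move=> sn; split => // sw; move: sn; rewrite sw subrr normr0.
  by apply/negP; rewrite -ltNge exprn_gt0.
apply: cvge_to_le (ge0_nondecreasing_set_cvg_integral _ _ _ _) _ => //.
- move=> n m nm; apply/subsetPset; apply: setIS => s /=; apply: le_trans.
  by rewrite ler_wiXn2l// invf_le1// ler1n.
- by move=> n; exact: measurable_funTS.
- by move=> n s _; exact: riesz_kernel_ge0.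
exists 0%N => // n _ /=.
pose phi s := (1%:E + \sum_(k < n) (p ^+ k.+1)%:E * (\1_(ball w ((2^-1) ^+ k)) s)%:E)%E.
have mt k : measurable_fun setT (fun s => (p ^+ k.+1)%:E * (\1_(ball w ((2^-1) ^+ k)) s)%:E)%E.
  apply: emeasurable_funM; first exact: measurable_cst.
  by apply/measurable_EFinP; apply: measurable_indic; exact: measurable_ball.
have t0 k s : (0 <= (p ^+ k.+1)%:E * (\1_(ball w ((2^-1) ^+ k)) s)%:E)%E.
  by rewrite mule_ge0// lee_fin ?exprn_ge0// ltW.
have phi0 s : (0 <= phi s)%E by rewrite adde_ge0// sume_ge0.
have msum : measurable_fun setT
    (fun s => \sum_(k < n) (p ^+ k.+1)%:E * (\1_(ball w ((2^-1) ^+ k)) s)%:E)%E.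
  exact: emeasurable_sum.
have mphi : measurable_fun setT phi by exact: emeasurable_funD.
apply: (@le_trans _ _ (\int[lebesgue_measure]_(s in F n) phi s)%E).
  apply: ge0_le_integral => //; [exact: mF|by move=> s _; exact: riesz_kernel_ge0|exact: measurable_funTS
    |exact: measurable_funTS|].
  move=> s [_ /= sn]; rewrite /riesz_kernel ifF; last first.
    apply/negP => /eqP sw; move: sn; rewrite sw subrr normr0.
    by apply/negP; rewrite -ltNge exprn_gt0.
  rewrite /phi; under eq_bigr do rewrite -EFinM.
  rewrite sumEFin -EFinD lee_fin (le_trans (@powRN_le_dyadic _ _ _ _ (ltW g0) sn))//.
  rewrite lerD2l ler_sum// => k _; rewrite indicE /ball/= distrC.
  by rewrite (_ : (s \in _) = (`|w - s| < 2^-1 ^+ k))//; apply/idP/idP; rewrite inE.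
apply: (@le_trans _ _ (\int[lebesgue_measure]_(s in D) phi s)%E).
  by apply: ge0_subset_integral => //; [exact: mF|exact: measurable_itv|exact: measurable_funTS|exact: subIsetl].
rewrite /phi ge0_integralD//; last 3 first.
- exact: measurable_itv.
- by move=> s _; rewrite sume_ge0.
- exact: measurable_funTS.
rewrite integral_cst; last exact: measurable_itv.
rewrite /= /D lebesgue_measure_itv/= lte01 oppr0 adde0 mule1 -/D.
rewrite EFinD leeD2l// ge0_integral_sum//; last 2 first.
- exact: measurable_itv.
- by move=> k; apply: measurable_funTS; exact: mt.
apply: (@le_trans _ _ (\sum_(k < n) (p ^+ k.+1 * (2 * (2^-1) ^+ k))%:E)%E).
  apply: lee_sum => k _; rewrite ge0_integralZl_EFin//; last 3 first.
  - exact: measurable_itv.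
  - by apply: measurable_funTS; apply/measurable_EFinP; apply: measurable_indic; exact: measurable_ball.
  - by rewrite exprn_ge0// ltW.
  rewrite integral_indic; [|exact: measurable_itv|exact: measurable_ball].
  rewrite EFinM lee_wpmul2l ?lee_fin ?exprn_ge0 ?(ltW p0)//.
  have <- : lebesgue_measure (ball w ((2^-1) ^+ k)) = (2 * (2^-1) ^+ k)%:E.
    by rewrite lebesgue_measure_ball// mulr_natl.
  by apply: measureIl; [exact: measurable_ball|exact: measurable_itv].
rewrite sumEFin lee_fin (eq_bigr (fun k : 'I_n => (p / 2) ^+ k * (2 * p))); last first.
  by move=> k _; rewrite expr_div_n exprS exprVn; ring.
rewrite -mulr_suml mulrC ler_pM2l ?mulr_gt0// -[leRHS]mul1r ler_pdivlMr//.
have := subrX1 (p / 2) n; set S := \sum_(i < n) _ => HS.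
rewrite (_ : S * _ = 1 - (p / 2) ^+ n); last by rewrite -[RHS]opprB HS; ring.
by rewrite lerBlDr lerDl exprn_ge0// divr_ge0// ltW.
Qed.

(** Gives one constant for all exponents up to [g0]. The summand 1 covers distances above 1, where
    the smaller exponent gives the larger kernel. *)
Lemma riesz_kernel_le1D (R : realType) (g g0 u v : R) : 0 < g <= g0 ->
  (riesz_kernel g u v <= 1 + riesz_kernel g0 u v)%E.
Proof.
move=> /andP[gp gg0]; rewrite /riesz_kernel; case: ifPn => [_|uv]; first by rewrite addey.
rewrite -EFinD lee_fin; have t0 : 0 < `|u - v| by rewrite normr_gt0 subr_eq0.
have [t1|t1] := leP 1 `|u - v|.
  by rewrite (le_trans (@powRN_le1 _ _ _ (ltW gp) t1))// lerDl powR_ge0.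
rewrite (@le_trans _ _ (`|u - v| `^ (- g0)))// ?lerDr//.
by apply: ger_powR; [rewrite t0 ltW|rewrite lerN2].
Qed.

(* An upper bound, at distance [z], for the Riesz kernel averaged over one uniform
   variable of weight [eta]. *)
Definition smooth_bound (R : realType) (C M g eta z : R) : R :=
  if M * eta <= z then ((1 - 2 / M) * z) `^ (- g) else C * eta `^ (- g).

(** Far from the diagonal the noise moves the distance by at most [2 * eta], hence by a fraction
    [2 / M] of it. Near the diagonal, scaling by [eta] reduces to [integral_riesz_le]. The constant
    must not depend on [g], because the exponent [beta + e] is fixed only after [C] and the
    scales. *)
Lemma smooth_riesz_le (R : realType) (g0 : R) : 0 < g0 < 1 ->
  exists2 C : R, 1 <= C & forall M g eta x x' s' : R,
    2 < M -> 0 < g <= g0 -> 0 < eta <= 1 -> 0 <= x <= 1 -> 0 <= x' <= 1 -> 0 <= s' <= 1 ->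
    (\int[lebesgue_measure]_(s in `[0%R, 1%R])
       riesz_kernel g (smooth_map R eta (x, s)) (smooth_map R eta (x', s'))
     <= (smooth_bound R C M g eta `|x - x'|)%:E)%E.
Proof.
move=> g01; have [C C0 HC] := @integral_riesz_le R g0 g01.
exists (1 + C); first by rewrite lerDl ltW.
move=> M g eta x x' s' M2 /andP[gp gg0] /andP[e0 e1] /andP[x0 x1] /andP[x'0 x'1] /andP[s'0 s'1].
have mD : measurable (`[0, 1]%classic : set (measurableTypeR R)) by exact: measurable_itv.
have mr g' w : measurable_fun setT (riesz_kernel g' ^~ w : R -> \bar R).
  by apply: kernel_measurable_l; exact: measurable_riesz_kernel.
have mr' g' w : measurable_fun setT (fun s => riesz_kernel g' (smooth_map R eta (x, s)) w).
  apply: (measurableT_comp (mr g' w)).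
  apply: (measurableT_comp (f := smooth_map R eta) (g := fun s => (x, s))) => //.
  exact: measurable_fun_pair.
have I1 : lebesgue_measure (`[0, 1]%classic : set (measurableTypeR R)) = 1%E.
  by rewrite lebesgue_measure_itv/= lte01 oppr0 adde0.
rewrite /smooth_bound; have [Mz|_] := leP (M * eta) `|x - x'|.
  have M0 : 0 < M by lra.
  have z0 : 0 < `|x - x'| by rewrite (lt_le_trans _ Mz)// mulr_gt0.
  have c0 : 0 < 1 - 2 / M by rewrite subr_gt0 ltr_pdivrMr// mul1r.
  have eM : 2 * eta <= 2 / M * `|x - x'|.
    by rewrite -mulrA ler_pM2l// ler_pdivlMl.
  set B := _ `^ _.
  rewrite -[leRHS]mule1 -I1 -integral_cst//; apply: ge0_le_integral => //.
  - by move=> s _; exact: riesz_kernel_ge0.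
  - by apply: measurable_funTS; exact: mr'.
  move=> s /=; rewrite in_itv/= => /andP[s0 s1].
  have lb : (1 - 2 / M) * `|x - x'| <= `|smooth_map R eta (x, s) - smooth_map R eta (x', s')|.
    rewrite /smooth_map/= (_ : (1 - eta) * x + eta * s - ((1 - eta) * x' + eta * s')
      = (x - x') - eta * ((x - x') - (s - s'))); last by ring.
    apply: le_trans (lerB_dist _ _); rewrite normrM (gtr0_norm e0).
    have : `|(x - x') - (s - s')| <= 2 by rewrite ler_norml; apply/andP; split; lra.
    by rewrite -(ler_pM2l e0); lra.
  rewrite /riesz_kernel ifF.
    by rewrite lee_fin; apply: le_powRN lb; [exact: ltW|exact: mulr_gt0].
  apply/negP => /eqP uv; move: lb; rewrite uv subrr normr0; apply/negP.
  by rewrite -ltNge mulr_gt0.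
(* The point that makes the difference of the two smoothed positions equal to [eta * (s - w)]; it
   may lie outside [[0, 1]]. *)
pose w := s' - (1 - eta) / eta * (x - x').
have E s : riesz_kernel g (smooth_map R eta (x, s)) (smooth_map R eta (x', s')) =
    ((eta `^ (- g))%:E * riesz_kernel g s w)%E.
  have d : smooth_map R eta (x, s) - smooth_map R eta (x', s') = eta * (s - w).
    by rewrite /smooth_map/w/=; field; rewrite gt_eqF.
  rewrite /riesz_kernel -subr_eq0 d mulf_eq0 gt_eqF//= subr_eq0; case: ifP => _.
    by rewrite gt0_muley// lte_fin powR_gt0.
  by rewrite -EFinM normrM (gtr0_norm e0) powRM// ltW.
rewrite [leLHS](_ : _ = \int[lebesgue_measure]_(s in `[0%R, 1%R])
    ((eta `^ (- g))%:E * riesz_kernel g s w))%E; last by apply: eq_integral => s _; exact: E.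
rewrite ge0_integralZl_EFin//; last 3 first.
- by move=> s _; exact: riesz_kernel_ge0.
- by apply: measurable_funTS; exact: mr.
- exact: powR_ge0.
rewrite mulrC EFinM lee_wpmul2l ?lee_fin ?powR_ge0//.
apply: (@le_trans _ _ (\int[lebesgue_measure]_(s in `[0%R, 1%R]) (1 + riesz_kernel g0 s w))%E).
  apply: ge0_le_integral => //.
  - by move=> s _; exact: riesz_kernel_ge0.
  - by apply: measurable_funTS; exact: mr.
  - by apply: measurable_funTS; apply: emeasurable_funD => //; exact: mr.
  - by move=> s _; apply: riesz_kernel_le1D; rewrite gp.
rewrite ge0_integralD//; last 2 first.
- by move=> s _; exact: riesz_kernel_ge0.
- by apply: measurable_funTS; exact: mr.
by rewrite integral_cst//= I1 mule1 EFinD leeD2l.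
Qed.

(** * Averaging over scales *)

(** The largest power of two not exceeding [Y] dominates the sum, so the number of terms does not
    matter. *)
Lemma sum_pow2_le (R : realType) n (Y : R) : 0 <= Y ->
  \sum_(j < n) 2 ^+ j * (2 ^+ j <= Y)%R%:R <= 2 * Y.
Proof.
move=> Y0; have S m : \sum_(j < m) 2 ^+ j * (2 ^+ j <= Y)%R%:R <= 2 ^+ m :> R.
  elim: m => [|m IH]; first by rewrite big_ord0 exprn_ge0.
  rewrite big_ord_recr/= exprS mulr_natl mulr2n lerD//.
  by rewrite ler_piMr ?exprn_ge0// -[leRHS]/(1%:R) ler_nat leq_b1.
elim: n => [|n IH]; first by rewrite big_ord0 mulr_ge0.
rewrite big_ord_recr/=; have [nY|_] := leP (2 ^+ n) Y; last by rewrite mulr0 addr0.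
rewrite mulr1 (le_trans (lerD (S n) (lexx _)))//; lra.
Qed.

Lemma smooth_bound_ge0 (R : realType) (C M g eta z : R) : 0 <= C ->
  0 <= smooth_bound R C M g eta z.
Proof.
by move=> C0; rewrite /smooth_bound; case: ifP => _; rewrite ?mulr_ge0 ?powR_ge0.
Qed.

(** In both ranges the base of the power is at least [eta]: off the diagonal it is at least
    [(M - 2) * eta], which is where [3 <= M] enters. This trades Potter's exponent [beta + e] for
    [beta]. *)
Lemma smooth_bound_exponent (R : realType) (C M g e eta z : R) :
  3 <= M -> 0 <= C -> 0 <= e -> 0 < eta -> 0 < g ->
  smooth_bound R C M (g + e) eta z <= eta `^ (- e) * smooth_bound R C M g eta z.
Proof.
move=> M3 C0 e0 eta0 g0; rewrite /smooth_bound opprD.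
have M0 : 0 < M by lra.
have [Mz|_] := leP (M * eta) z; last first.
  rewrite powRD; last by rewrite (gt_eqF eta0) implybT.
  by rewrite [eta `^ (- g) * _]mulrC mulrCA.
have tz : eta <= (1 - 2 / M) * z.
  apply: (@le_trans _ _ ((1 - 2 / M) * (M * eta))).
    rewrite mulrA mulrBl mul1r divfK ?gt_eqF// ler_peMl ?(ltW eta0)//; lra.
  by rewrite ler_wpM2l// subr_ge0 ler_pdivrMr// mul1r; lra.
rewrite powRD; last by rewrite (gt_eqF (lt_le_trans eta0 tz)) implybT.
by rewrite mulrC ler_wpM2r ?powR_ge0// le_powRN.
Qed.

(* Averaging over the scales [eta_j ~ 2^(-j/beta)]: for fixed [z] the near-diagonal terms
   form a geometric sum bounded by a multiple of [z^-beta] independent of the number of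
   scales, so their average is negligible. *)
Lemma smooth_bound_average (R : realType) (C beta theta : R) :
  1 <= C -> 0 < beta < 1 -> 0 < theta ->
  exists (M r delta : R) (N : nat) (eta : nat -> R),
    [/\ 3 <= M, (0 < N)%N, 0 < r, 0 < delta <= 1 &
     (forall j, (j < N)%N -> r <= eta j <= 1) /\
     forall z, 0 <= z -> \sum_(j < N) smooth_bound R C M beta (eta j) z
       <= N%:R * ((1 + theta) * Num.max z delta `^ (- beta))].
Proof.
move=> C1 /andP[b0 b1] th0.
(* Large enough for [(1 - 2 / M)^-1 <= 1 + theta / 2]. *)
pose M := 3 + 4 / theta; have M3 : 3 <= M by rewrite lerDl divr_ge0// ltW.
have M0 : 0 < M by lra.
have M1 : 1 <= M by lra.
(* [h j] is the threshold [M * eta j] between the two ranges, with [h j ^ -beta = 2^j]. *)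
pose h (j : nat) : R := 2 `^ (- (j%:R / beta)).
have h0 j : 0 < h j by rewrite powR_gt0.
have h1 j : h j <= 1 by rewrite powRN_le1// ?ler1n// divr_ge0// ltW.
have hb j : h j `^ (- beta) = 2 ^+ j.
  by rewrite /h -powRrM mulrNN divfK ?gt_eqF// powR_mulrn.
have hdec i j : (i <= j)%N -> h j <= h i.
  move=> ij; apply: ler_powR; first by rewrite ler1n.
  by rewrite lerN2 ler_pM2r ?invr_gt0// ler_nat.
pose eta j := M^-1 * h j.
have Meta j : M * eta j = h j by rewrite /eta mulVKf// gt_eqF.
have eta0 j : 0 < eta j by rewrite mulr_gt0// invr_gt0.
pose K := C * M; have K1 : 1 <= K by rewrite (le_trans C1)// ler_peMr//; lra.
have K0 : 0 < K by lra.
have etab j : C * eta j `^ (- beta) <= K * 2 ^+ j.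
  rewrite /eta powRM ?invr_ge0 ?(ltW M0) ?(ltW (h0 _))// hb mulrA ler_wpM2r ?exprn_ge0//.
  rewrite ler_wpM2l//; first by lra.
  rewrite -powR_inv1 ?(ltW M0)// -powRrM mulrNN mul1r.
  by rewrite ler1_powR ?(ltW b1).
(* The near-diagonal terms add up to at most [2 * K * Y], which must be below
   [N * (theta / 2) * Y]. *)
pose N := (Num.truncn (4 * K / theta)).+1.
have NK : 4 * K / theta <= N%:R by exact/ltW/truncnS_gt.
(* Below [delta] every scale is in the near-diagonal range, and the whole sum is at most
   [K * 2^N = delta^-beta]. *)
pose delta := (K * 2 ^+ N) `^ (- beta^-1).
have KN1 : 1 <= K * 2 ^+ N by rewrite mulr_ege1// exprn_ege1// ler1n.
have d0 : 0 < delta by rewrite powR_gt0; lra.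
have db : delta `^ (- beta) = K * 2 ^+ N.
  by rewrite /delta -powRrM mulrNN mulVf ?gt_eqF// powRr1; lra.
have d1 : delta <= 1 by rewrite powRN_le1 ?invr_ge0 ?(ltW b0).
have dh j : (j < N)%N -> delta <= h j.
  move=> jN; apply: (@le_trans _ _ (h N)); last by apply: hdec; exact: ltnW.
  have -> : h N = (2 ^+ N) `^ (- beta^-1) by rewrite -powR_mulrn// -powRrM mulrN.
  by apply: le_powRN; rewrite ?invr_ge0 ?(ltW b0) ?exprn_gt0 ?ler_peMl ?exprn_ge0.
have etamin j : (j < N)%N -> eta N <= eta j <= 1.
  move=> jN; rewrite ler_pM2l ?invr_gt0// hdec ?(ltnW jN)//=.
  by rewrite /eta mulr_ile1 ?invr_ge0 ?(ltW M0) ?(ltW (h0 _))// invf_le1.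
exists M, (eta N), delta, N, eta; split; rewrite ?d0 ?eta0//; split => // z z0.
have [dz|zd] := leP delta z; last first.
  apply: (@le_trans _ _ (K * 2 ^+ N)).
    apply: (@le_trans _ _ (\sum_(j < N) K * 2 ^+ j)).
      apply: ler_sum => j _; rewrite /smooth_bound Meta ifF ?etab//.
      by apply/negbTE; rewrite -ltNge (lt_le_trans zd)// dh.
    rewrite -mulr_sumr ler_pM2l//.
    have [N' ->] : exists N', N = N' by exists N.
    elim: N' => [|n IH]; first by rewrite big_ord0.
    by rewrite big_ord_recr/= exprS mulr_natl mulr2n lerD.
  rewrite -db mulrA ler_peMl ?powR_ge0// mulr_ege1//; last by lra.
  by rewrite ler1n.
have zp : 0 < z by exact: lt_le_trans dz.
pose Y := z `^ (- beta); have Y0 : 0 < Y by rewrite powR_gt0.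
have cM : (1 - 2 / M) `^ (- beta) <= 1 + theta / 2.
  have c0 : 0 < 1 - 2 / M by rewrite subr_gt0 ltr_pdivrMr// mul1r; lra.
  have c1 : 1 <= (1 - 2 / M)^-1.
    by rewrite invf_ge1// gerBl divr_ge0// ltW.
  rewrite -(mulN1r beta) powRrM powR_inv1 ?(ltW c0)//.
  apply: (le_trans (ler1_powR c1 (ltW b1))).
  rewrite -[leLHS]mul1r ler_pdivrMr// /M.
  rewrite (_ : (1 + theta / 2) * (1 - 2 / (3 + 4 / theta)) = 1 + theta ^+ 2 / 2 / (3 * theta + 4)).
    by rewrite lerDl divr_ge0 ?divr_ge0 ?sqr_ge0//; lra.
  by field; rewrite ?gt_eqF//; lra.
have term (j : 'I_N) : smooth_bound R C M beta (eta j) z <=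
    (1 + theta / 2) * Y + K * (2 ^+ j * (2 ^+ j <= Y)%R%:R).
  rewrite /smooth_bound Meta; have [hz|zh] := leP (h j) z.
    rewrite powRM ?(ltW zp)//; last by rewrite subr_ge0 ler_pdivrMr// mul1r; lra.
    rewrite (le_trans (ler_wpM2r (ltW Y0) cM))// lerDl.
    by apply: mulr_ge0; [exact: ltW|apply: mulr_ge0; [exact: exprn_ge0|exact: ler0n]].
  (* A near-diagonal scale has [z < h j], that is [2^j = h j ^ -beta <= Y]. *)
  have -> : (2 ^+ j <= Y) by rewrite -hb; apply: le_powRN => //; exact: ltW.
  rewrite mulr1 (le_trans (etab j))// lerDr mulr_ge0 ?(ltW Y0)//; lra.
apply: (le_trans (ler_sum _ (fun j _ => term j))).
rewrite big_split/= sumr_const card_ord -mulr_sumr -[_ *+ N]mulr_natl.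
apply: (le_trans (lerD (lexx _) (ler_wpM2l (ltW K0) (@sum_pow2_le _ N Y (ltW Y0))))).
rewrite -/Y; have : 4 * K <= N%:R * theta by rewrite -ler_pdivrMr.
rewrite -(ler_pM2r Y0); nra.
Qed.

(** * Comparison of minimal energies *)

Lemma sume_const (R : realType) (x : \bar R) n :
  (\sum_(j < n) x = n%:R%:E * x)%E.
Proof.
elim: n => [|n IH]; first by rewrite big_ord0 mul0e.
by rewrite big_ord_recr/= IH -natr1 EFinD ge0_muleDl ?mul1e// lee_fin.
Qed.

Lemma measurable_smooth_bound (R : realType) (C M g eta : R) :
  measurable_fun setT (smooth_bound R C M g eta).
Proof.
apply: measurable_fun_ifT => /=.
- by apply: measurable_fun_ler.
- apply: (measurableT_comp (@measurable_powR R (- g))); exact: mulrl_measurable.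
- exact: measurable_cst.
Qed.

Lemma kernel_measurable_dist (R : realType) (f : R -> R) : measurable_fun setT f ->
  kernel_measurable R (fun u v => (f `|u - v|)%:E).
Proof.
move=> mf; apply/measurable_EFinP; apply: (measurableT_comp mf).
by apply: measurableT_comp => //; apply: measurable_funB.
Qed.

(** Each smoothing of [mu] competes for the lower bound [J], so [J] is at most the mean of the [N]
    smoothed energies. Stated for a general kernel because it serves both the Riesz kernel and the
    covariance. *)
Lemma energy_average_le (R : realType) (C M g c : R) (N : nat) (eta : nat -> R)
    (J : \bar R) (mu : probability R R) (K k : R -> R -> \bar R) :
  0 <= C -> 0 <= c -> (0 < N)%N -> (forall j, (j < N)%N -> 0 < eta j <= 1) ->
  mu \in prob01 -> (forall nu, nu \in prob01 -> (J <= energy nu K)%E) ->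
  kernel_measurable R K -> (forall u v, 0 <= K u v)%E ->
  kernel_measurable R k -> (forall u v, 0 <= k u v)%E ->
  (forall (j : nat) (x x' s' : R), (j < N)%N -> 0 <= x <= 1 -> 0 <= x' <= 1 -> 0 <= s' <= 1 ->
    (\int[lebesgue_measure]_(s in `[0%R, 1%R])
       K (smooth_map R (eta j) (x, s)) (smooth_map R (eta j) (x', s'))
     <= (c * smooth_bound R C M g (eta j) `|x - x'|)%:E)%E) ->
  (forall u v : R, 0 <= u <= 1 -> 0 <= v <= 1 ->
    ((c * \sum_(j < N) smooth_bound R C M g (eta j) `|u - v|)%:E <= N%:R%:E * k u v)%E) ->
  (J <= energy mu k)%E.
Proof.
move=> C0 c0 N0 eta01 mu1 JK mK K0 mk k0 KG Gk.
have NR : 0 < N%:R :> R by rewrite ltr0n.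
pose G (j : 'I_N) (u v : R) := (c * smooth_bound R C M g (eta j) `|u - v|)%:E.
have mG j : kernel_measurable R (G j).
  apply: (@kernel_measurable_dist R (fun z => c * smooth_bound R C M g (eta j) z)).
  by apply: measurable_funM => //; exact: measurable_smooth_bound.
have G0 j u v : (0 <= G j u v)%E.
  by rewrite lee_fin mulr_ge0// smooth_bound_ge0.
rewrite -(@lee_pmul2l _ N%:R%:E)//.
apply: (@le_trans _ _ (\sum_(j < N) J)%E).
  by rewrite sume_const.
apply: (@le_trans _ _ (\sum_(j < N) energy mu (G j))%E).
  apply: lee_sum => j _; have /andP[e0 e1] := eta01 j (ltn_ord j).
  have e01 : 0 <= eta j <= 1 by rewrite ltW.
  apply: (le_trans (JK _ (prob01_smooth _ _ _ e01 mu1))).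
  by apply: energy_smooth_le => // x x' s' ? ? ?; exact: KG.
rewrite -energy_sum// -energyZ//.
apply: energy_le => //.
- exact: emeasurable_sum.
- by move=> u v; rewrite sume_ge0.
- by apply: emeasurable_funM => //; exact: measurable_cst.
- by move=> u v; rewrite mule_ge0.
- move=> u v u01 v01; apply: le_trans (Gk u v u01 v01).
  by rewrite sumEFin -mulr_sumr.
Qed.

Lemma energy_cst (R : realType) (mu : probability R R) (c : R) : mu \in prob01 ->
  energy mu (fun _ _ => c%:E) = c%:E.
Proof.
move=> /set_mem mu1; rewrite /energy.
have int_cst : (\int[mu]_(x in `[0%R, 1%R]) c%:E = c%:E)%E.
  by rewrite integral_cst// [X in (_ * X)%E](_ : _ = 1%E) ?mule1//; exact: mu1.
by under eq_integral do rewrite int_cst.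
Qed.

Lemma max_dist_powRN_le_riesz (R : realType) (g : R) (u v : R) (d : R) : 0 <= g ->
  0 < d -> ((Num.max `|u - v| d `^ (- g))%:E <= riesz_kernel g u v)%E.
Proof.
move=> g0 d0; rewrite /riesz_kernel; case: ifPn => [_|uv]; first by rewrite leey.
by rewrite lee_fin le_powRN ?le_max ?lexx// normr_gt0 subr_eq0.
Qed.

(** Distances in [[0, 1]] are at most 1. This makes the inverse in the limit a genuine one. *)
Lemma energy_riesz_ge1 (R : realType) (g : R) (mu : probability R R) : 0 <= g ->
  mu \in prob01 -> (1 <= energy mu (riesz_kernel g))%E.
Proof.
move=> g0 mu1; rewrite -(@energy_cst R mu 1 mu1); apply: energy_le => //.
- exact: measurable_cst.
- exact: measurable_riesz_kernel.
- by move=> u v; exact: riesz_kernel_ge0.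
move=> u v /andP[u0 u1] /andP[v0 v1]; have := @max_dist_powRN_le_riesz R g u v 1 g0 ltr01.
by rewrite max_r ?powR1// ler_norml; apply/andP; split; lra.
Qed.

(** One factor [1 + theta] pays for the averaging over scales, the other for Potter's bounds. The
    order of choices matters: [theta] fixes the scales, and only then is [e] taken small against
    their lower bound [r]. *)
Lemma minimal_energy_asymptotic (R : realType) (RX L : R -> R) (beta theta : R)
    (mub : probability R R) :
  (forall t, 0 < RX t) -> (forall t, RX (- t) = RX t) -> (forall t, RX t <= RX 0) ->
  continuous RX -> 0 < beta < 1 -> slowly_varying L ->
  (forall t : R, t != 0 -> RX t = L t / (`|t| `^ beta)) ->
  mub \in prob01 ->
  (forall mu : probability R R, mu \in prob01 ->
     (energy mub (riesz_kernel beta) <= energy mu (riesz_kernel beta))%E) ->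
  0 < theta ->
  let J a := ereal_inf [set energy mu (fun u v => (RX (a * (u - v)))%:E) | mu in prob01] in
  (energy mub (riesz_kernel beta) < +oo)%E /\
  \forall a \near +oo,
    ((RX a)%:E * energy mub (riesz_kernel beta) <= ((1 + theta) ^+ 2)%:E * J a)%E /\
    (J a <= ((1 + theta) ^+ 2 * RX a)%:E * energy mub (riesz_kernel beta))%E.
Proof.
move=> RX0 RXN RX_le cRX b01 slowL RXE mub1 mubmin th0 J.
have /andP[b0 b1] := b01.
have th1 : 0 < 1 + theta by lra.
have q0 : 0 < (1 + theta) ^+ 2 by rewrite exprn_gt0.
have mRX a : kernel_measurable R (fun u v => (RX (a * (u - v)))%:E).
  apply/measurable_EFinP; apply: (measurableT_comp (continuous_measurable_fun cRX)).
  by apply: measurable_funM => //; apply: measurable_funB.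
have RXabs a u v : RX (a * (u - v)) = RX (a * `|u - v|).
  have [uv|uv] := ger0P (u - v); first by [].
  by rewrite mulrN RXN.
(* Midway between [beta] and 1, which leaves room for the exponent [beta + e]. *)
pose g0 := (1 + beta) / 2; have g01 : 0 < g0 < 1.
  by apply/andP; split; rewrite /g0; lra.
have [C C1 HC] := @smooth_riesz_le R g0 g01.
have C0 : 0 <= C by lra.
have [M [r [delta [N [eta [M3 N0 r0 d01 [reta HG]]]]]]] :=
  @smooth_bound_average R C beta theta C1 b01 th0.
have /andP[d0 d1] := d01.
have M2 : 2 < M by lra.
have eta01 j : (j < N)%N -> 0 < eta j <= 1.
  by move=> /reta /andP[re ->]; rewrite (lt_le_trans r0 re).
have NR : 0 < N%:R :> R by rewrite ltr0n.
have mriesz g : kernel_measurable R (riesz_kernel g) by exact: measurable_riesz_kernel.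
have riesz0 g u v : (0 <= riesz_kernel g u v :> \bar R)%E by exact: riesz_kernel_ge0.
have lower mu k : mu \in prob01 -> kernel_measurable R (fun u v => (k u v)%:E) ->
    (forall u v, 0 <= k u v) ->
    (forall u v : R, 0 <= u <= 1 -> 0 <= v <= 1 ->
      (1 + theta) * Num.max `|u - v| delta `^ (- beta) <= k u v) ->
    (energy mub (riesz_kernel beta) <= energy mu (fun u v => (k u v)%:E))%E.
  move=> mu1 mk k0 Hk.
  apply: (@energy_average_le R C M beta 1 N eta _ mu (riesz_kernel beta)) => //.
  - by move=> j x x' s' jN x01 x'01 s'01; rewrite mul1r HC ?eta01 ?b0//=; rewrite /g0; lra.
  - move=> u v u01 v01; rewrite mul1r -EFinM lee_fin.
    by rewrite (le_trans (HG _ (normr_ge0 _)))// ler_pM2l// Hk.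
split.
  (* Finiteness of the minimal Riesz energy: this constant dominates the truncated kernel. *)
  pose k (u v : R) := (1 + theta) * delta `^ (- beta).
  apply: (@le_lt_trans _ _ (energy mub (fun u v => (k u v)%:E))).
    apply: lower => //; first by rewrite /kernel_measurable /k; exact: measurable_cst.
      by move=> u v; rewrite mulr_ge0 ?powR_ge0// ltW.
    by move=> u v _ _; rewrite ler_pM2l// le_powRN ?(ltW b0)// le_max lexx orbT.
  by rewrite energy_cst// ltry.
have [a1 a10 Ha1] := @potter_lower R RX L beta RX0 b0 slowL RXE theta delta
  (fun A => @continuous_positive_lbound R RX A cRX RX0) th0 d01.
have lr : ln r <= 0.
  have /andP[rr ee] := reta _ N0; apply: ln_le0; exact: le_trans rr ee.
have lr1 : 0 < 1 - ln r by lra.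
(* The first bound keeps [beta + e <= g0]; the second makes [expR e * eta j ^ -e] at most
   [1 + theta] at every scale. *)
pose e := Num.min ((1 - beta) / 2) (ln (1 + theta) / (1 - ln r)).
have lth : 0 < ln (1 + theta) by rewrite ln_gt0// ltrDl.
have e0 : 0 < e by rewrite lt_min !divr_gt0// subr_gt0.
have eg0 : 0 < beta + e <= g0.
  have : e <= (1 - beta) / 2 by rewrite ge_min lexx.
  by rewrite addr_gt0// /g0; lra.
have eth j : (j < N)%N -> expR e * eta j `^ (- e) <= 1 + theta.
  move=> /reta /andP[re _]; apply: (@le_trans _ _ (expR e * r `^ (- e))).
    by rewrite ler_pM2l ?expR_gt0// le_powRN// ltW.
  rewrite -ler_ln ?posrE ?mulr_gt0 ?expR_gt0 ?powR_gt0//.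
  rewrite lnM ?posrE ?expR_gt0 ?powR_gt0// expRK ln_powR.
  have : e * (1 - ln r) <= ln (1 + theta) by rewrite -ler_pdivlMr// ge_min lexx orbT.
  lra.
have [a2 a20 Ha2] := @potter_upper R RX L beta RX0 b0 slowL RXE _ e RX_le e0.
exists (Num.max a1 a2); split; first exact: num_real.
move=> a; rewrite gt_max => /andP[/ltW a1a /ltW a2a]; split.
  rewrite -lee_pdivrMl//; apply: le_ereal_inf_tmp => _ [mu /mem_set mu1 <-].
  rewrite lee_pdivrMl// -lee_pdivlMl// muleA -EFinM -energyZ//; last 2 first.
  - by rewrite mulr_ge0 ?invr_ge0 ?ltW.
  - by move=> u v; rewrite lee_fin ltW.
  apply: (lower mu (fun u v => ((RX a)^-1 * (1 + theta) ^+ 2) * RX (a * (u - v)))) => //.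
  - apply/measurable_EFinP; apply: measurable_funM; first exact: measurable_cst.
    by apply/measurable_EFinP; exact: mRX.
  - by move=> u v; rewrite !mulr_ge0 ?invr_ge0 ?ltW.
  move=> u v /andP[u0 u1] /andP[v0 v1].
  rewrite -mulrA ler_pdivlMl// expr2 -[X in _ <= X]mulrA RXabs mulrCA ler_pM2l// mulrC.
  by apply: Ha1 => //; rewrite normr_ge0 ler_norml; apply/andP; split; lra.
rewrite -energyZ//; last by rewrite mulr_ge0 ?ltW.
have cr : 0 <= RX a * (1 + theta) by rewrite mulr_ge0 ?ltW.
(* Converse bound: the smoothings of [mub] are test measures for the infimum [J a]. *)
apply: (@energy_average_le R C M beta (RX a * (1 + theta)) N eta _ mub
  (fun u v => (RX (a * (u - v)))%:E)) => //.
- by move=> nu nu1; apply: ereal_inf_lbound; exists nu => //; exact/set_mem.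
- by move=> u v; rewrite lee_fin ltW.
- by apply: emeasurable_funM; [exact: measurable_cst|exact: mriesz].
- by move=> u v; rewrite mule_ge0// lee_fin mulr_ge0 ?ltW.
- move=> j x x' s' jN x01 x'01 s'01; have /andP[ej0 ej1] := eta01 j jN.
  apply: (@le_trans _ _ ((RX a * expR e)%:E * (smooth_bound R C M (beta + e) (eta j) `|x - x'|)%:E)%E);
      last first.
    rewrite -EFinM lee_fin -!mulrA ler_pM2l//.
    apply: (le_trans (ler_wpM2l (expR_ge0 e)
      (@smooth_bound_exponent R C M beta e (eta j) `|x - x'| M3 C0 (ltW e0) ej0 b0))).
    by rewrite mulrA ler_wpM2r ?eth ?smooth_bound_ge0.
  apply: le_trans (lee_wpmul2l _ (HC M (beta + e) (eta j) x x' s' M2 eg0 _ x01 x'01 s'01));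
    [|by rewrite lee_fin mulr_ge0 ?expR_ge0 ?ltW|by rewrite ej0].
  have mI : measurable (`[0, 1]%classic : set (measurableTypeR R)) by exact: measurable_itv.
  have mphi : measurable_fun setT (fun s => smooth_map R (eta j) (x, s)).
    apply: (measurableT_comp (f := smooth_map R (eta j)) (g := fun s => (x, s))) => //.
    exact: measurable_fun_pair.
  have mrphi : measurable_fun setT (fun s => riesz_kernel (beta + e)
      (smooth_map R (eta j) (x, s)) (smooth_map R (eta j) (x', s'))).
    by apply: (measurableT_comp (kernel_measurable_l R _ _ (mriesz (beta + e))) mphi).
  rewrite -ge0_integralZl_EFin//; last 2 first.
  - exact: measurable_funTS.
  - by rewrite mulr_ge0 ?expR_ge0 ?ltW.
  apply: ge0_le_integral => //.
  + by move=> s _; rewrite lee_fin ltW.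
  + apply: measurable_funTS.
    by apply: (measurableT_comp (kernel_measurable_l R _ _ (mRX a)) mphi).
  + by apply: measurable_funTS; apply: emeasurable_funM => //; exact: measurable_cst.
  move=> s /=; rewrite in_itv/= => s01.
  have conv y t : 0 <= y <= 1 -> 0 <= t <= 1 -> 0 <= smooth_map R (eta j) (y, t) <= 1.
    by move=> /andP[y0 y1] /andP[t0 t1]; rewrite /smooth_map/=; apply/andP; split; nra.
  have /andP[u0 u1] := conv x s x01 s01; have /andP[v0 v1] := conv x' s' x'01 s'01.
  (* On the diagonal the right-hand side is infinite; elsewhere this is [potter_upper]. *)
  rewrite /riesz_kernel; case: ifPn => [_|uv].
    by rewrite gt0_muley ?leey// lte_fin mulr_gt0 ?expR_gt0.
  rewrite -EFinM lee_fin RXabs -mulrA -ler_pdivrMl// [leLHS]mulrC Ha2//.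
  rewrite normr_gt0 subr_eq0 uv ler_norml; apply/andP; split; lra.
- move=> u v u01 v01.
  apply: (@le_trans _ _ (N%:R%:E * (((1 + theta) ^+ 2 * RX a)%:E
      * (Num.max `|u - v| delta `^ (- beta))%:E))%E).
    rewrite -!EFinM lee_fin; apply: (le_trans (ler_wpM2l cr (HG _ (normr_ge0 _)))).
    by rewrite le_eqVlt; apply/orP; left; apply/eqP; ring.
  rewrite lee_pmul2l// lee_pmul2l//; last by rewrite lte_fin mulr_gt0.
  by apply: max_dist_powRN_le_riesz => //; exact: ltW.
Qed.

(** * From minimal energies to the limit of [RX a * CX RX a] *)

Theorem theorem7p2 (R : realType) (d : measure_display) (T : measurableType d)
  (P : probability T R) (X : R -> T -> R) (RX : R -> R) (beta : R)
  (mu_beta : probability R R) :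
  centered_gaussian_process P X ->
  (forall s t : R, ('E_P[fun w => (X s w * X t w)%R] = (RX (t - s))%:E)%E) ->
  (forall w : T, continuous (fun t : R => X t w)) ->
  (forall t : R, 0 < RX t) ->
  0 < beta < 1 ->
  (exists L : R -> R, slowly_varying L /\
     forall t : R, t != 0 -> RX t = L t / (`|t| `^ beta)) ->
  mu_beta \in prob01 ->
  (forall mu : probability R R, mu \in prob01 ->
     (energy mu_beta (riesz_kernel beta) <= energy mu (riesz_kernel beta))%E) ->
  (fun a : R => RX a * CX RX a) @ +oo --> (fine (energy mu_beta (riesz_kernel beta)))^-1.
Proof.
move=> gX covE cX RX0 b01 [L [slowL RXE]] mub1 mubmin.
have [mX _] := gX; have /andP[b0 b1] := b01.
have covX s t : (\int[P]_w (X s w * X t w)%:E)%E = (RX (t - s))%:E.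
  by rewrite -covE unlock.
have RXN t : RX (- t) = RX t by exact: covariance_even covX t.
have RX_le t : RX t <= RX 0 by exact: covariance_le0 mX covX t.
have cRX : continuous RX by exact: gaussian_covariance_continuous gX covX cX.
have asym theta := @minimal_energy_asymptotic R RX L beta theta mu_beta
  RX0 RXN RX_le cRX b01 slowL RXE mub1 mubmin.
have [Ey _] := asym 1 ltr01.
have E1 := @energy_riesz_ge1 R beta mu_beta (ltW b0) mub1.
move: Ey E1 asym; set E := energy _ _ => Ey E1 asym.
have Efin : E \is a fin_num by rewrite ge0_fin_numE// (le_trans _ E1).
set I := fine E; have EI : E = I%:E by rewrite fineK.
have I1 : 1 <= I by rewrite -lee_fin -EI.
have I0 : 0 < I by lra.
(* Then [(1 + theta)^2 - 1 <= 3 * theta < e]. *)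
apply/cvgrPdist_lt => e e0; pose theta := Num.min 1 (e / 4).
have th0 : 0 < theta by rewrite lt_min ltr01 divr_gt0.
have th1 : theta <= 1 by rewrite ge_min lexx.
have the : theta <= e / 4 by rewrite ge_min lexx orbT.
have [_] := asym theta th0; apply: filterS => a /=; rewrite /CX.
set J := ereal_inf _ => -[lo up].
pose q := (1 + theta) ^+ 2; have q1 : 1 <= q by rewrite /q expr2; nra.
have qe : q - 1 < e by rewrite /q expr2; nra.
(* [J] is finite and positive, so neither [fine] nor the inverse in [CX] takes a default value. *)
have Jy : (J < +oo)%E by rewrite (le_lt_trans up)// EI -EFinM ltry.
have J0 : (0 < J)%E.
  have : (0 < q%:E * J)%E.
    by rewrite (lt_le_trans _ lo)// EI -EFinM lte_fin mulr_gt0.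
  by rewrite pmule_rgt0// lte_fin; lra.
have Jfin : J \is a fin_num by rewrite ge0_fin_numE// ltW.
set j := fine J; have JE : J = j%:E by rewrite fineK.
have j0 : 0 < j by rewrite -lte_fin -JE.
move: lo up; rewrite JE EI -!EFinM !lee_fin -/q => lo up.
(* The ratio of [RX a * CX RX a] to its limit; the two bounds place it between [q^-1] and [q], and
   [I >= 1] lets the factor [I^-1] be dropped. *)
pose y := RX a / j * I.
have yq : y <= q by rewrite /y mulrAC ler_pdivrMr.
have qy : 1 <= q * y by rewrite /y mulrA mulrA mulrAC ler_pdivlMr// mul1r.
have -> : I^-1 - RX a * j^-1 = I^-1 * (1 - y).
  by rewrite /y; field; rewrite !gt_eqF.
rewrite normrM gtr0_norm ?invr_gt0//.
have y1 : `|1 - y| <= q - 1 by rewrite ler_norml; apply/andP; split; nra.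
apply: le_lt_trans qe; apply: le_trans y1.
by rewrite ler_piMl// invf_le1.
Qed.
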